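(* Assume $T$ is a theory in a separable language $\mathcal L$, possibly incomplete, and $P$ is a property which is definable by uniform families of formulas such that $T$ has a model satisfying $P$. Let $\mathfrak T_T$ be the space of functionals defined in the context (with $\Sigma$ the set of all $\mathcal L^+$-sentences). (1) There exists a dense $G_\delta$ subset $\mathfrak G$ of $\mathfrak T_T$ such that every $s\in\mathfrak G$ determines a unique model $A_s$ of $T$ and an interpretation $\bar a_s$ of the constants $\bar c$ in $A_s$ such that each sort $S$ in $A_s$ is the closure of $\{a_j^S:j\in\mathbb N\}$ and $s=s_{A_s,\bar a_s}$. (2) The set $\mathfrak G_P:=\{s\in\mathfrak G:A_s\text{ has }P\}$ is a nonempty $G_\delta$ subset of $\mathfrak G$. (3) Furthermore, if $T$ is a complete theory, then $\mathfrak G_P$ is dense in $\mathfrak G$.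
   Context: Continuous logic. A language $\mathcal L$ consists of sorts (each with a symbol for a bounded complete metric), function symbols and relation symbols with prescribed domains and ranges (a sort, respectively a compact real interval) and prescribed uniform continuity moduli; an $\mathcal L$-structure interprets these accordingly. Terms are built from variables and function symbols; atomic formulas are relation (or metric) symbols applied to terms; formulas are obtained from atomic ones by applying continuous functions $f:\mathbb R^n\to\mathbb R$ and quantifiers $\sup_x,\inf_x$ over a sort; $\varphi^A(\bar a)$ denotes the value. A theory is a set of sentences; $A\models T$ if $\varphi^A=0$ for all $\varphi\in T$; $T$ is complete if any two of its models assign the same value to each sentence. $\mathcal L$ is separable (relative to $T$) if it has countably many sorts and, for each tuple $\bar x$, the space of formulas in $\bar x$ is separable in the seminorm $\|\varphi\|_T=\sup\{|\varphi^A(\bar a)|:A\models T,\ \bar a\in A\}$. Uniform families. A countable set $\mathcal F$ of nonnegative-valued formulas in the same free variables is a uniform family with respect to a theory $T'$ if all its members satisfy $|\varphi(\bar x)-\varphi(\bar y)|\le u(d(\bar x,\bar y))$ in all models of $T'$ for a common uniform continuity modulus $u$. A property $P$ is definable by uniform families of formulas if there are a theory $T'$ and uniform families $\mathcal F_n$ ($n\in\mathbb N$) with respect to $T'$ such that $A$ has $P$ iff $A\models T'$ and $\inf_{\varphi\in\mathcal F_n}\varphi^A(\bar a)=0$ for all $n$ and all $\bar a$ of the appropriate sort. Forcing set-up. $\mathcal L^+$ is obtained from $\mathcal L$ by adding, for each sort $S$, new constant symbols $c_n^S$, $n\in\mathbb N$; its sentences have the form $\varphi(\bar c)$ with $\varphi(\bar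 x)$ an $\mathcal L$-formula and $\bar c$ a tuple of new constants. Let $\Sigma$ be the set of all $\mathcal L^+$-sentences, a real vector space with seminorm $\|\varphi(\bar c)\|_T=\sup_{A,\bar a}|\varphi(\bar a)^A|$ over models $A$ of $T$ and tuples $\bar a$ of the appropriate sort. Given $A\models T$ and an assignment $\bar a=(a_i^S)$ of elements $a_i^S$ of sort $S$ in $A$ to all constants $c_i^S$, define the functional $s_{A,\bar a}$ on $\Sigma$ by $s_{A,\bar a}(\varphi(\bar c))=\varphi(\bar a)^A$. Let $\mathfrak T_T=\{s_{A,\bar a}:A\models T,\ \bar a\text{ in }A\}$, a weak*-compact subset of the dual of $(\Sigma,\|\cdot\|_T)$, with the relative weak* topology. *)

(* Defs.v *)
From HB Require Import structures.
From mathcomp Require Import all_boot all_order all_algebra.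
From mathcomp Require Import all_classical all_reals all_analysis.

Set Implicit Arguments.
Unset Strict Implicit.
Unset Printing Implicit Defensive.
Import Order.TTheory GRing.Theory Num.Theory.
Import numFieldNormedType.Exports.

Local Open Scope classical_set_scope.
Local Open Scope ring_scope.

(* [idx n] is the type ['I_n] of positions in an [n]-tuple, presented as an
   iterated [option] so that prepending an entry to a (dependently typed) tuple
   is definitional: position [None] is the new entry, [Some i] an old one. *)
Fixpoint idx (n : nat) : finType :=
  if n is m.+1 then option (idx m) : finType else void : finType.

Definition vnil (X : Type) : idx 0 -> X := fun i => match i with end.

Definition vcons (X : Type) n (x : X) (v : idx n -> X) : idx n.+1 -> X :=
  fun i : option (idx n) => if i is Some j then v j else x.

(* The tuples of elements of [A] whose entries have the sorts listed in [v]. *)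
Definition tuple_in (X : Type) (A : X -> Type) n (v : idx n -> X) : Type :=
  forall i, A (v i).

Definition tnil (X : Type) (A : X -> Type) : tuple_in A (@vnil X) :=
  fun i => match i with end.

Definition tcons (X : Type) (A : X -> Type) n x (v : idx n -> X)
    (a : A x) (e : tuple_in A v) : tuple_in A (vcons x v) :=
  fun i : option (idx n) =>
    match i return A (vcons x v i) with Some j => e j | None => a end.

Arguments tcons {X} A {n x v} a e.

Definition tdist (R : realType) (X : Type) (A : X -> metricType R) n
    (v : idx n -> X) (a b : tuple_in A v) : R :=
  \big[Num.max/0]_(i : idx n) mdist (a i) (b i).

(* [u] is only used on [0, +oo[; it is not required to be monotone. *)
Definition modulus (R : realType) (u : R -> R) : Prop :=
  [/\ u 0 = 0, forall t, 0 <= t -> 0 <= u t & u @ (0 : R)^'+ --> (0 : R)].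

Record language (R : realType) := Language {
  sorts : Type;
  dbound : sorts -> R;
  fsym : Type;
  farity : fsym -> nat;
  fdom : forall f, idx (farity f) -> sorts;
  fcod : fsym -> sorts;
  fmod : fsym -> R -> R;
  fmod_modulus : forall f, modulus (fmod f);
  rsym : Type;
  rarity : rsym -> nat;
  rdom : forall r, idx (rarity r) -> sorts;
  rmin : rsym -> R;
  rmax : rsym -> R;
  rmin_le_rmax : forall r, rmin r <= rmax r;
  rmod : rsym -> R -> R;
  rmod_modulus : forall r, modulus (rmod r) }.

Record structure (R : realType) (L : language R) := Structure {
  carrier :> sorts L -> metricType R;
  carrier_nonempty : forall s, [set: carrier s] !=set0;
  carrier_complete : forall s (F : set_system (carrier s)),
    ProperFilter F -> cauchy F -> exists x : carrier s, F --> x;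
  mdist_bound : forall s (x y : carrier s), mdist x y <= dbound s;
  fint : forall f : fsym L, tuple_in carrier (@fdom R L f) -> carrier (fcod f);
  fint_mod : forall f (a b : tuple_in carrier (@fdom R L f)),
    mdist (fint a) (fint b) <= fmod f (tdist a b);
  rint : forall r : rsym L, tuple_in carrier (@rdom R L r) -> R;
  rint_range : forall r (a : tuple_in carrier (@rdom R L r)),
    rmin r <= rint a <= rmax r;
  rint_mod : forall r (a b : tuple_in carrier (@rdom R L r)),
    `|rint a - rint b| <= rmod r (tdist a b) }.
Arguments fint {R L} A f a : rename.
Arguments rint {R L} A r a : rename.

Definition isomorphism (R : realType) (L : language R) (A B : structure L)
    (h : forall s, A s -> B s) : Prop :=
  [/\ forall s, bijective (h s),
      forall s (x y : A s), mdist (h s x) (h s y) = mdist x y,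
      forall f (a : tuple_in (carrier A) (@fdom R L f)),
        h (fcod f) (fint A f a) = fint B f (fun i => h _ (a i)) &
      forall r (a : tuple_in (carrier A) (@rdom R L r)),
        rint A r a = rint B r (fun i => h _ (a i))].

(* [term v s] and [formula v]: terms of sort [s], and formulas, whose free
   variables are among [x_i], [i : idx n], where [x_i] has sort [v i]. *)
Inductive term (R : realType) (L : language R) n (v : idx n -> sorts L) :
    sorts L -> Type :=
| tvar i : term v (v i)
| tapp (f : fsym L) (t : forall i, term v (fdom (f := f) i)) : term v (fcod f).
Arguments tvar {R L n v} i.
Arguments tapp {R L n v} f t.

(* [fsup] and [finf] bind the variable [None] of the extended tuple. *)
Inductive formula (R : realType) (L : language R) n (v : idx n -> sorts L) :
    Type :=
| frel (r : rsym L) (t : forall i, term v (rdom (r := r) i))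
| fdist s (t1 t2 : term v s)
| fconn m (g : 'rV[R]_m -> R) (g_cont : continuous g) (phi : 'I_m -> formula v)
| fsup s (phi : formula (vcons s v))
| finf s (phi : formula (vcons s v)).
Arguments frel {R L n v} r t.
Arguments fdist {R L n v s} t1 t2.
Arguments fconn {R L n v m g} g_cont phi.
Arguments fsup {R L n v} s phi.
Arguments finf {R L n v} s phi.

Fixpoint teval (R : realType) (L : language R) (A : structure L) n
    (v : idx n -> sorts L) s (t : term v s) (a : tuple_in (carrier A) v) : A s :=
  match t in term _ s return A s with
  | tvar i => a i
  | tapp f t => fint A f (fun i => teval (t i) a)
  end.

Fixpoint feval (R : realType) (L : language R) (A : structure L) n
    (v : idx n -> sorts L) (phi : formula v) : tuple_in (carrier A) v -> R :=
  match phi with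
  | frel r t => fun a => rint A r (fun i => teval (t i) a)
  | fdist s t1 t2 => fun a => mdist (teval t1 a) (teval t2 a)
  | fconn m g _ phi => fun a => g (\row_i feval (phi i) a)
  | fsup s phi => fun a =>
      sup (range (fun x : A s => feval phi (tcons (carrier A) x a)))
  | finf s phi => fun a =>
      inf (range (fun x : A s => feval phi (tcons (carrier A) x a)))
  end.
Arguments feval {R L} A {n v} phi a.

Definition sentence (R : realType) (L : language R) : Type :=
  formula (@vnil (sorts L)).

Definition seval (R : realType) (L : language R) (A : structure L)
  (phi : sentence L) : R := feval A phi (@tnil _ (carrier A)).

Definition models (R : realType) (L : language R) (A : structure L)
  (T : set (sentence L)) : Prop := forall phi, T phi -> seval A phi = 0.

Definition complete_theory (R : realType) (L : language R)
    (T : set (sentence L)) : Prop :=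
  forall A B : structure L, models A T -> models B T ->
  forall phi, seval A phi = seval B phi.

Lemma add_continuous (R : realType) :
  continuous (fun x : 'rV[R]_2 => x 0 0 + x 0 1).
Proof.
move=> x; apply: (@cvgD R R^o); first exact: nbhs_filter.
  exact: (@coord_continuous R 1 2 0 0 x).
exact: (@coord_continuous R 1 2 0 1 x).
Qed.

Lemma scale_continuous (R : realType) (c : R) :
  continuous (fun x : 'rV[R]_1 => c * x 0 0).
Proof.
move=> x; apply: cvgMl_tmp; first exact: nbhs_filter.
exact: (@coord_continuous R 1 1 0 0 x).
Qed.

Definition fadd (R : realType) (L : language R) n (v : idx n -> sorts L)
    (phi psi : formula v) : formula v :=
  fconn (@add_continuous R) (fun i => if i == 0 then phi else psi).

Definition fscale (R : realType) (L : language R) n (v : idx n -> sorts L)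
    (c : R) (phi : formula v) : formula v :=
  fconn (@scale_continuous R c) (fun=> phi).

Lemma feval_bounded (R : realType) (L : language R) n (v : idx n -> sorts L)
    (phi : formula v) :
  exists M : R, forall (A : structure L) (a : tuple_in (carrier A) v),
    `|feval A phi a| <= M.
Proof.
have supP (I : Type) (F : I -> R) M : (exists i : I, True) ->
    (forall i, `|F i| <= M) -> `|sup (range F)| <= M.
  move=> [i0 _] FM; have ubF : ubound (range F) M.
    by move=> _ [i _ <-]; exact: le_trans (ler_norm _) (FM i).
  rewrite ler_norml; apply/andP; split.
    apply: (@le_trans _ _ (F i0)).
      by have /(_ i0) := FM; rewrite ler_norml => /andP[].
    by apply: ub_le_sup; [exists M|exists i0].
  by apply: ge_sup => //; exists (F i0), i0.
elim: phi => {n v} [n v r t|n v s t1 t2|n v m g gc phi IH|n v s phi [M IH]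
    |n v s phi [M IH]].
- exists (`|rmin r| + `|rmax r|) => A a /=.
  have /andP[lo hi] := rint_range (fun i => teval (t i) a).
  rewrite ler_norml; apply/andP; split.
    apply: le_trans lo; rewrite opprD -[leRHS]addr0 lerD ?oppr_le0//.
    by rewrite lerNl -normrN ler_norm.
  by apply: (le_trans hi); rewrite -[leLHS]add0r lerD// ler_norm.
- exists (dbound s) => A a /=.
  by rewrite ger0_norm ?mdist_ge0// mdist_bound.
- have /choice[M HM] := IH.
  have cK : compact [set x : 'rV[R]_m |
      forall i, `[- M i, M i]%classic (x ord0 i)].
    apply: (@rV_compact _ _ (fun i => `[- M i, M i]%classic)) => i.
    exact: segment_compact.
  have /compact_bounded[N [_ HN]] :=
    continuous_compact (continuous_subspaceT gc) cK.
  exists (N + 1) => A a /=; apply: HN; first by rewrite ltrDl.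
  exists (\row_i feval A (phi i) a) => //= i.
  by rewrite mxE in_itv/= -ler_norml; exact: HM.
- exists M => A a /=; apply: supP => [|x]; last exact: IH.
  by have [x _] := @carrier_nonempty _ _ A s; exists x.
- exists M => A a /=; rewrite /inf normrN image_comp; apply: supP => [|x].
    by have [x _] := @carrier_nonempty _ _ A s; exists x.
  by rewrite /= normrN; exact: IH.
Qed.

Definition fnorm (R : realType) (L : language R) (T : set (sentence L)) n
    (v : idx n -> sorts L) (phi : formula v) : R :=
  sup [set r | exists (A : structure L) (a : tuple_in (carrier A) v),
                 models A T /\ r = `|feval A phi a|].

Definition separable_language (R : realType) (L : language R)
    (T : set (sentence L)) : Prop :=
  countable [set: sorts L] /\
  forall n (v : idx n -> sorts L), exists2 D : set (formula v), countable D &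
    forall phi e, 0 < e ->
      exists2 psi, D psi & fnorm T (fadd phi (fscale (-1) psi)) < e.

Definition uniform_family (R : realType) (L : language R)
    (T' : set (sentence L)) n (v : idx n -> sorts L) (F : set (formula v)) :
    Prop :=
  [/\ countable F,
      forall phi, F phi -> forall A, models A T' ->
        forall a : tuple_in (carrier A) v, 0 <= feval A phi a &
      exists2 u : R -> R, modulus u &
        forall phi, F phi -> forall A, models A T' ->
        forall a b : tuple_in (carrier A) v,
          `|feval A phi a - feval A phi b| <= u (tdist a b)].

(* The infimum is taken in the extended reals, so that it is [+oo], not [0],
   over an empty family. *)
Definition definable_by_uniform_families (R : realType) (L : language R)
    (P : structure L -> Prop) : Prop :=
  exists (T' : set (sentence L)) (n : nat -> nat)
         (v : forall k, idx (n k) -> sorts L)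
         (F : forall k, set (formula (v k))),
    (forall k, uniform_family T' (F k)) /\
    forall A : structure L, P A <->
      models A T' /\
      forall k (a : tuple_in (carrier A) (v k)),
        ereal_inf [set (feval A phi a)%:E | phi in F k] = 0%E.

Section AddConstants.
Variables (R : realType) (L : language R).

Let fsymc : Type := (fsym L + sorts L * nat)%type.

Let fdomc (f : fsymc) : idx (if f is inl f then farity f else 0) -> sorts L :=
  match f with inl f => @fdom R L f | inr _ => @vnil _ end.

Let fmodc (f : fsymc) : R -> R := if f is inl f then fmod f else cst 0.

Let fmodc_modulus f : modulus (fmodc f).
Proof.
by case: f => [f|c]; [exact: fmod_modulus|split=> //; exact: cvg_cst].
Qed.

(* The symbol [inr (s, j)] is the [j]-th new constant of sort [s]. *)
Definition add_constants : language R := {|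
  sorts := sorts L;
  dbound := @dbound R L;
  fsym := fsymc;
  farity := fun f => if f is inl f then farity f else 0;
  fdom := fdomc;
  fcod := fun f => match f with inl f => fcod f | inr c => c.1 end;
  fmod := fmodc;
  fmod_modulus := fmodc_modulus;
  rsym := rsym L;
  rarity := @rarity R L;
  rdom := @rdom R L;
  rmin := @rmin R L;
  rmax := @rmax R L;
  rmin_le_rmax := @rmin_le_rmax R L;
  rmod := @rmod R L;
  rmod_modulus := @rmod_modulus R L |}.

Definition assignment (A : structure L) : Type := forall s, nat -> A s.

Section Expand.
Variables (A : structure L) (a : assignment A).

Let fintc (f : fsymc) :
    tuple_in (carrier A) (@fdom R add_constants f) ->
    A (@fcod R add_constants f) :=
  match f with inl f => fint A f | inr c => fun=> a c.1 c.2 end.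

Let fintc_mod f b c :
  mdist (@fintc f b) (@fintc f c) <= @fmod R add_constants f (tdist b c).
Proof.
by case: f b c => [f|c] b b' /=; [exact: fint_mod|rewrite mdistxx].
Qed.

Definition expand : structure add_constants :=
  @Structure R add_constants A (@carrier_nonempty R L A)
    (@carrier_complete R L A) (@mdist_bound R L A) fintc fintc_mod
    (@rint R L A) (@rint_range R L A) (@rint_mod R L A).

End Expand.

End AddConstants.

Section Functionals.
Variables (R : realType) (L : language R) (T : set (sentence L)).

Definition csentence : Type := sentence (add_constants L).

Definition cnorm (phi : csentence) : R :=
  sup [set r | exists (A : structure L) (a : assignment A),
                 models A T /\ r = `|seval (expand a) phi|].

(* The dual of [(csentence, cnorm)]; its weak* topology is the topology of
   pointwise convergence, i.e. the one induced by [{ptws csentence -> R}]. *)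
Definition dual : set {ptws csentence -> R} :=
  [set s | [/\ forall phi psi, s (fadd phi psi) = s phi + s psi,
               forall c phi, s (fscale c phi) = c * s phi &
               exists M, forall phi, `|s phi| <= M * cnorm phi]].

Definition functional (A : structure L) (a : assignment A) :
  {ptws csentence -> R} := fun phi => seval (expand a) phi.

Definition functional_space : set {ptws csentence -> R} :=
  [set s | exists (A : structure L) (a : assignment A),
             models A T /\ s = functional a].

Lemma functional_space_dual : functional_space `<=` dual.
Proof.
move=> _ [A [a [AT ->]]]; split=> [phi psi|c phi|].
- by rewrite /functional /seval /= !mxE.
- by rewrite /functional /seval /= !mxE.
- exists 1 => phi; rewrite mul1r; apply: ub_le_sup; last by exists A, a.
  have [M HM] := feval_bounded phi.
  by exists M => _ [B [b [_ ->]]]; exact: HM.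
Qed.

Definition generated (A : structure L) (a : assignment A) : Prop :=
  forall t, closure (range (a t)) = [set: A t].

Definition represents (s : functional_space) (A : structure L)
    (a : assignment A) : Prop :=
  [/\ models A T, generated a & set_val s = functional a].

End Functionals.

(* Main.v *)
Require Import Defs.
From Stdlib Require List.
From HB Require Import structures.
From mathcomp Require Import all_boot all_order all_algebra.
From mathcomp Require Import all_classical all_reals all_analysis.
From mathcomp Require Import borel_hierarchy lra.

(** A functional [s_{A,a}] is generic when the constants satisfy the
    Tarski-Vaught test: every infimum [inf_x phi(x, c)] is approached by values
    [phi(c_j, c)]. By separability countably many formulas suffice, so the
    generic functionals form a G_delta set; by the Tarski-Vaught theorem the
    closure of the constants is then an elementary substructure, which realizes
    the same functional and is unique because an isometry between dense
    sequences extends to the completions.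

    Density needs neither compactness nor Baire category. A sentence of [L+]
    mentions finitely many constants, so the values of the others can be changed
    inside the same model [A]; a Loewenheim-Skolem construction chooses them so
    that the Tarski-Vaught test holds. When [T] is complete, the finitely many
    constants of a basic open set are first moved to a given model with [P], by
    comparing there the value of [inf_x psi(x)].

    Finally, [A_s] has [P] iff [s] annihilates [T'] and, for all [k], all
    constants [c] and all [m], some [phi] in [F_k] has [s(phi(c)) < 1/(m+1)];
    uniformity of [F_k] passes from the constants to their closure. *)

Set Implicit Arguments.
Unset Strict Implicit.
Unset Printing Implicit Defensive.
Import Order.TTheory GRing.Theory Num.Theory.
Import numFieldNormedType.Exports.

Local Open Scope classical_set_scope.
Local Open Scope ring_scope.

(** * Substitution of constants *)

Section Tuples.
Variables (X : Type) (A : X -> Type).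

Lemma tuple0_eq (v : idx 0 -> X) (a b : tuple_in A v) : a = b.
Proof. by apply: functional_extensionality_dep => -[]. Qed.

Lemma tconsE n x (v : idx n -> X) (y : tuple_in A (vcons x v)) :
  tcons A (y None) (fun i => y (Some i)) = y.
Proof. by apply: functional_extensionality_dep => -[]. Qed.

(** Sorts form a bare type: their equality is decided classically and [z] is transported along the
    resulting proof. *)
Definition upd (a : forall x, nat -> A x) (c : X * nat) (z : A c.1) :
    forall x, nat -> A x :=
  fun x j => match pselect (c.1 = x) with
             | left e => if c.2 == j then ecast x (A x) e z else a x j
             | right _ => a x j
             end.

Lemma upd_same a c z : @upd a c z c.1 c.2 = z.
Proof.
rewrite /upd; case: pselect => // e; rewrite eqxx.
by rewrite (Prop_irrelevance e erefl).
Qed.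

Lemma upd_other a c z x j : (x, j) <> c -> @upd a c z x j = a x j.
Proof.
rewrite /upd; case: pselect => // e; case: eqP => // e' [].
by rewrite -e -e'; case: (c).
Qed.

Lemma upd_id a c : @upd a c (a c.1 c.2) = a.
Proof.
apply: functional_extensionality_dep => x; apply/funext => j.
rewrite /upd; case: pselect => // e; case: eqP => // <-.
by case: _ / e.
Qed.

(** The constants listed in [l] become free variables, so that a sentence of [L+] mentioning only
    them turns into an [L]-formula. *)
Fixpoint ctx (l : seq (X * nat)) : idx (size l) -> X :=
  match l return idx (size l) -> X with
  | [::] => @vnil X
  | c :: l => vcons c.1 (@ctx l)
  end.
Arguments ctx : clear implicits.

(* When a constant is repeated in [l], its first occurrence gives its value. *)
Fixpoint assign (l : seq (X * nat)) (a : forall x, nat -> A x) :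
    tuple_in A (ctx l) -> forall x, nat -> A x :=
  match l return tuple_in A (ctx l) -> _ with
  | [::] => fun=> a
  | c :: l => fun y =>
      @upd (@assign l a (fun i => y (Some i))) c (y None)
  end.

Fixpoint values (l : seq (X * nat)) (a : forall x, nat -> A x) :
    tuple_in A (ctx l) :=
  match l return tuple_in A (ctx l) with
  | [::] => @tnil X A
  | c :: l => tcons A (a c.1 c.2) (@values l a)
  end.

(** Each update replaces a value by itself, so repetitions in [l] do no harm. *)
Lemma assign_values l a : @assign l a (@values l a) = a.
Proof. by elim: l => [//|c l IH] /=; rewrite [assign _ _]IH upd_id. Qed.

Lemma values_eq l a b : (forall c, List.In c l -> a c.1 c.2 = b c.1 c.2) ->
  @values l a = @values l b.
Proof.
elim: l => [//|c l IH] ab /=; rewrite ab; last by left.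
by rewrite IH// => d dl; apply: ab; right.
Qed.

End Tuples.
Arguments ctx {X} l _.
Arguments upd {X A} a c z.
Arguments assign {X A} l a y.
Arguments values {X A} l a.

Lemma dep_choice (I : Type) (Y : I -> Type) (Q : forall i, Y i -> Prop) :
  (forall i, exists y, Q i y) -> exists f : forall i, Y i, forall i, Q i (f i).
Proof.
by move=> QP; exists (fun i => sval (cid (QP i))) => i; exact: svalP.
Qed.

Lemma In_flat (I : finType) X (l : I -> seq X) i c :
  List.In c (l i) -> List.In c (List.flat_map l (enum I)).
Proof.
move=> cl; apply/List.in_flat_map; exists i; split=> //.
have := mem_enum predT i; rewrite inE.
elim: (enum _) => //= j k IHk; rewrite inE => /orP[/eqP->|/IHk]; by auto.
Qed.

Section Weakening.
Variables (R : realType) (L : language R).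

Fixpoint tshift n (v : idx n -> sorts L) s x (t : term v s) :
    term (vcons x v) s :=
  match t in term _ s return term (vcons x v) s with
  | tvar i => @tvar R L n.+1 (vcons x v) (Some i)
  | tapp f t => tapp f (fun i => tshift x (t i))
  end.

Lemma teval_tshift (A : structure L) n (v : idx n -> sorts L) s x (t : term v s)
    (y : tuple_in (carrier A) (vcons x v)) :
  teval (tshift x t) y = teval t (fun i => y (Some i)).
Proof.
elim: t => [//|f t IH] /=; congr fint.
by apply: functional_extensionality_dep => i; rewrite IH.
Qed.

(** The usual lifting of a substitution under a binder. *)
Definition tlift n (v : idx n -> sorts L) m
    (w : idx m -> sorts L) (e : forall i, term w (v i)) s
    (i : idx n.+1) : term (vcons s w) (vcons s v i) :=
  match i return term (vcons s w) (@vcons _ n s v i) with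
  | None => @tvar R L m.+1 (vcons s w) None
  | Some j => tshift s (e j)
  end.

End Weakening.

Section Translation.
Variables (R : realType) (L : language R).
Implicit Types (A : structure L) (n m : nat).

Let Lc := add_constants L.

(* A term of [L+] is turned into a term of [L] by a substitution [e] of its
   variables and a choice of terms denoting the constants of [l]; [Q] restricts
   the assignments and values for which those terms are correct. *)
Definition names m (w : idx m -> sorts L) (l : seq (sorts L * nat))
    (Q : forall A, assignment A -> tuple_in (carrier A) w -> Prop) :=
  forall c, List.In c l -> exists t : term w c.1,
    forall A a y, @Q A a y -> teval t y = a c.1 c.2.

(** The list [l] collects the constants occurring in [t]. It is fixed before [w], [e] and [Q],
    because these change when the induction on formulas passes a quantifier. *)
Lemma term_elim n (v : idx n -> sorts L) s (t : @term R Lc n v s) :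
  exists l, forall m (w : idx m -> sorts L) (e : forall i, term w (v i)) Q,
    names l Q ->
    exists t' : term w s, forall A a y, @Q A a y ->
      @teval R Lc (Defs.expand a) n v s t (fun i => teval (e i) y) = teval t' y.
Proof.
elim: t => [i|[f|c] t IH].
- by exists [::] => m w e Q _; exists (e i).
- have /choice[l Hl] := IH.
  exists (List.flat_map l (enum (idx (farity f)))) => m w e Q nQ.
  have {}nQ i : names (l i) Q.
    by move=> c cl; apply: nQ; exact: In_flat cl.
  have /dep_choice[t' Ht'] : forall i, exists t' : term w (fdom (f := f) i),
      forall A a y, @Q A a y ->
      @teval R Lc (Defs.expand a) n v _ (t i) (fun i => teval (e i) y) = teval t' y.
    by move=> i; exact: Hl (nQ i).
  exists (tapp f t') => A a y qy /=; congr fint.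
  by apply: functional_extensionality_dep => i; exact: Ht'.
- exists [:: c] => m w e Q nQ; have [|t' Ht'] := nQ c; first by left.
  by exists t' => A a y qy /=; rewrite (Ht' _ _ _ qy).
Qed.

Lemma names_vcons m (w : idx m -> sorts L) l s Q : @names m w l Q ->
  @names m.+1 (vcons s w) l (fun A a y => Q A a (fun i => y (Some i))).
Proof.
move=> nQ c /nQ[t tE]; exists (tshift s t) => A a y qy.
by rewrite teval_tshift; exact: tE.
Qed.

(** Quantifiers leave the list of constants unchanged: below one, [e] is lifted and the terms naming
    constants are weakened. Since [expand a] has the carriers of [A], suprema and infima range over
    the same values on both sides. *)
Lemma formula_elim n (v : idx n -> sorts L) (phi : @formula R Lc n v) :
  exists l, forall m (w : idx m -> sorts L) (e : forall i, term w (v i)) Q,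
    names l Q ->
    exists psi : formula w, forall A a y, @Q A a y ->
      @feval R Lc (Defs.expand a) n v phi (fun i => teval (e i) y) =
      feval A psi y.
Proof.
have lift_eq m k (u : idx k -> sorts L) (w : idx m -> sorts L)
    (e : forall i, term w (u i)) s A (x : A s) (y : tuple_in (carrier A) w) :
    tcons (carrier A) x (fun i => teval (e i) y) =
    (fun i => teval (tlift e s i) (tcons (carrier A) x y)).
  by apply: functional_extensionality_dep => -[i|//] /=; rewrite teval_tshift.
elim: phi => {n v} [n v r t|n v s t1 t2|n v k g gc phi IH|n v s phi [l IH]
    |n v s phi [l IH]].
- have /dep_choice[l Hl] := fun i => term_elim (t i).
  exists (List.flat_map l (enum (idx (rarity r)))) => m w e Q nQ.
  have /dep_choice[t' Ht'] i : exists t' : term w (rdom (r := r) i),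
      forall A a y, @Q A a y ->
      @teval R Lc (Defs.expand a) n v _ (t i) (fun i => teval (e i) y) =
      teval t' y.
    by apply: Hl => c cl; apply: nQ; exact: In_flat cl.
  exists (@Defs.frel R L m w r t') => A a y qy /=; congr rint.
  by apply: functional_extensionality_dep => i; exact: Ht'.
- have [l1 H1] := term_elim t1; have [l2 H2] := term_elim t2.
  exists (l1 ++ l2) => m w e Q nQ.
  have [|t1' Ht1] := H1 _ w e Q.
    by move=> c cl; apply: nQ; apply/List.in_app_iff; left.
  have [|t2' Ht2] := H2 _ w e Q.
    by move=> c cl; apply: nQ; apply/List.in_app_iff; right.
  exists (@fdist R L m w s t1' t2') => A a y qy /=.
  by rewrite (Ht1 _ _ _ qy) (Ht2 _ _ _ qy).
- have /dep_choice[l Hl] := IH.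
  exists (List.flat_map l (enum 'I_k)) => m w e Q nQ.
  have /dep_choice[psi Hpsi] i : exists psi : formula w,
      forall A a y, @Q A a y ->
      @feval R Lc (Defs.expand a) n v (phi i) (fun i => teval (e i) y) =
      feval A psi y.
    by apply: Hl => c cl; apply: nQ; exact: In_flat cl.
  exists (@fconn R L m w k g gc psi) => A a y qy /=; congr g.
  by apply/rowP => i; rewrite !mxE (Hpsi i _ _ _ qy).
- exists l => m w e Q nQ; have [psi Hpsi] :=
    IH m.+1 (vcons s w) (tlift e s) _ (names_vcons s nQ).
  exists (@fsup R L m w s psi) => A a y qy /=; congr sup; apply: (congr1 (fun h => range h)).
  by apply/funext => x; rewrite lift_eq (Hpsi _ a).
- exists l => m w e Q nQ; have [psi Hpsi] :=
    IH m.+1 (vcons s w) (tlift e s) _ (names_vcons s nQ).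
  exists (@finf R L m w s psi) => A a y qy /=; congr inf; apply: (congr1 (fun h => range h)).
  by apply/funext => x; rewrite lift_eq (Hpsi _ a).
Qed.

Lemma names_ctx (l l' : seq (sorts L * nat)) :
  (forall c, List.In c l -> List.In c l') ->
  @names _ (ctx l') l (fun A a y => exists a0, a = assign l' a0 y).
Proof.
move=> ll' c /ll' {ll'}; elim: l' => [//|d l' IH] /= [<-|/IH[t tE]].
  by exists (@tvar R L _ (ctx (d :: l')) None) => A _ y [a ->]; rewrite upd_same.
(* If the head repeats [c], its variable overrides the one found in the tail. *)
have [<-|cd] := pselect (d = c).
  by exists (@tvar R L _ (ctx (d :: l')) None) => A _ y [a ->]; rewrite upd_same.
exists (tshift d.1 t) => A _ y [a ->]; rewrite teval_tshift upd_other; last first.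
  by rewrite -surjective_pairing => /esym.
by apply: tE; exists a.
Qed.

(** The formula [psi] depends neither on the structure nor on the values of the constants outside
    [l]; this lets constants be moved within a structure or to another one. *)
Lemma csentence_elim (phi : csentence L) : exists l (psi : formula (ctx l)),
  forall A a y, functional (assign l a y) phi = feval A psi y.
Proof.
have [l Hl] := formula_elim phi; exists l.
have [|psi Hpsi] := Hl _ (ctx l) (fun i => match i with end) _ (@names_ctx l l _).
  by [].
exists psi => A a y; rewrite -(Hpsi A (assign l a y)); last by exists a.
by congr feval; exact: tuple0_eq.
Qed.

Lemma term_intro n (v : idx n -> sorts L) s (t : term v s) m
    (w : idx m -> sorts L) (e : forall i, @term R Lc m w (v i)) :
  exists t' : @term R Lc m w s, forall A a y,
    @teval R Lc (@Defs.expand R L A a) m w s t' y =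
    teval t (fun i => @teval R Lc (Defs.expand a) m w _ (e i) y).
Proof.
elim: t => [i|f t /dep_choice[t' Ht']]; first by exists (e i).
exists (@tapp R Lc m w (inl f) t') => A a y /=; congr fint.
by apply: functional_extensionality_dep => i; rewrite Ht'.
Qed.

Lemma formula_intro n (v : idx n -> sorts L) (psi : formula v) m
    (w : idx m -> sorts L) (e : forall i, @term R Lc m w (v i)) :
  exists phi : @formula R Lc m w, forall A a y,
    @feval R Lc (@Defs.expand R L A a) m w phi y =
    feval A psi (fun i => @teval R Lc (Defs.expand a) m w _ (e i) y).
Proof.
elim: psi m w e => {n v} [n v r t|n v s t1 t2|n v k g gc psi IH|n v s psi IH
    |n v s psi IH] m w e.
- have /dep_choice[t' Ht'] := fun i => term_intro (t i) e.
  exists (@Defs.frel R Lc m w r t') => A a y /=; congr rint.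
  by apply: functional_extensionality_dep => i; rewrite Ht'.
- have [t1' Ht1] := term_intro t1 e; have [t2' Ht2] := term_intro t2 e.
  by exists (@fdist R Lc m w s t1' t2') => A a y /=; rewrite Ht1 Ht2.
- have /dep_choice[phi Hphi] := fun i => IH i m w e.
  exists (@fconn R Lc m w k g gc phi) => A a y /=; congr g.
  by apply/rowP => i; rewrite !mxE Hphi.
- have [phi Hphi] := IH _ _ (@tlift R Lc n v m w e s).
  exists (@fsup R Lc m w s phi) => A a y /=; congr sup; apply: (congr1 (fun h => range h)).
  apply/funext => x; rewrite Hphi; congr feval.
  by apply: functional_extensionality_dep => -[i|//] /=; rewrite teval_tshift.
- have [phi Hphi] := IH _ _ (@tlift R Lc n v m w e s).
  exists (@finf R Lc m w s phi) => A a y /=; congr inf; apply: (congr1 (fun h => range h)).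
  apply/funext => x; rewrite Hphi; congr feval.
  by apply: functional_extensionality_dep => -[i|//] /=; rewrite teval_tshift.
Qed.

Lemma instance_exists n (v : idx n -> sorts L) (psi : formula v)
    (k : idx n -> nat) : exists phi : csentence L, forall A (a : assignment A),
  functional a phi = feval A psi (fun i => a (v i) (k i)).
Proof.
pose e i : @term R Lc 0 (@vnil _) (v i) :=
  @tapp R Lc 0 _ (inr (v i, k i)) (fun i => match i with end).
by have [phi Hphi] := formula_intro psi e; exists phi => A a; exact: Hphi.
Qed.

(** The sentence [psi(c)], variable [i] being replaced by the constant of index [k i]. Only its
    values matter, so it is chosen from the existence statement. *)
Definition inst n (v : idx n -> sorts L) (psi : formula v) (k : idx n -> nat) :
  csentence L := sval (cid (instance_exists psi k)).

Lemma instE n (v : idx n -> sorts L) (psi : formula v) (k : idx n -> nat) A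
    (a : assignment A) :
  functional a (inst psi k) = feval A psi (fun i => a (v i) (k i)).
Proof. exact: svalP (cid (instance_exists psi k)) A a. Qed.

End Translation.

(** * Uniform continuity of formulas *)

Section UniformContinuity.
Variable R : realType.

Lemma finite_lower_bound (I : finType) (d : I -> R) :
  (forall i, 0 < d i) -> exists2 e, 0 < e & forall i, e <= d i.
Proof.
move=> d0; exists (\big[Num.min/1]_i d i); last by move=> i; exact: bigmin_le.
by apply/bigmin_gtP; split.
Qed.

Lemma modulus_small (u : R -> R) : modulus u -> forall e, 0 < e ->
  exists2 d, 0 < d & forall t, 0 <= t -> t < d -> u t < e.
Proof.
move=> [u0 up u_cvg] e e0.
have /cvgrPdist_lt/(_ _ e0)[d /= d0 Hd] := u_cvg.
(* The one-sided limit says nothing about [t = 0], which is covered by [u 0 = 0]. *)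
exists d => // t; rewrite le_eqVlt => /orP[/eqP<-|t0] td; first by rewrite u0.
have := Hd t; rewrite /= sub0r normrN sub0r normrN (gtr0_norm t0) => /(_ td t0).
by apply: le_lt_trans; exact: ler_norm.
Qed.

Lemma tdist_ge0 (X : Type) (A : X -> metricType R) n (v : idx n -> X)
  (a b : tuple_in A v) : 0 <= tdist a b.
Proof. by apply/bigmax_geP; left. Qed.

Lemma tdist_lt (X : Type) (A : X -> metricType R) n (v : idx n -> X)
    (a b : tuple_in A v) d :
  0 < d -> (forall i, mdist (a i) (b i) < d) -> tdist a b < d.
Proof. by move=> d0 H; apply/bigmax_ltP; split. Qed.

Lemma modulus_tuple (u : R -> R) : modulus u -> forall e, 0 < e ->
  exists2 d, 0 < d & forall (X : Type) (A : X -> metricType R) n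
    (v : idx n -> X) (a b : tuple_in A v),
    (forall i, mdist (a i) (b i) < d) -> u (tdist a b) < e.
Proof.
move=> /modulus_small + e e0 => /(_ _ e0)[d d0 H]; exists d => // X A n v a b ab.
by apply: H; [exact: tdist_ge0|exact: tdist_lt].
Qed.

(** Uniform continuity on the compact box [K], in a form where only [x] has to lie in the box. *)
Lemma connective_unif m (g : 'rV[R]_m -> R) (M : 'I_m -> R) (e : R) :
  continuous g -> 0 < e ->
  exists2 d, 0 < d & forall x y : 'rV_m, (forall i, `|x 0 i| <= M i) ->
    (forall i, `|x 0 i - y 0 i| < d) -> `|g x - g y| < e.
Proof.
move=> gc e0.
pose K := [set x : 'rV[R]_m | forall i, `[- M i, M i]%classic (x ord0 i)].
have cK : compact K.
  apply: (@rV_compact _ _ (fun i => `[- M i, M i]%classic)) => i.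
  exact: segment_compact.
pose P (d : R) (x : 'rV[R]_m) := forall y, `|x - y| < d -> `|g x - g y| < e.
(* Each point of [K] has a neighbourhood on which [P d] holds for all small [d]; by compactness, one
   range of small [d] serves all of [K]. *)
have /compact_near_coveringP/(_ _ (0^'+) P) := cK.
case=> [x Kx|d /= d0 Hd].
  have e20 : 0 < e / 2 by rewrite divr_gt0.
  have /cvgrPdist_lt/(_ _ e20)/nbhs_ballP[r /= r0 Hr] := gc x.
  exists (ball x (r / 2), [set d | d < r / 2]) => /=.
    split; first by apply: nbhsx_ballx; rewrite divr_gt0.
    by apply: nbhs_right_lt; rewrite divr_gt0.
  move=> [z d] /= [xz dr] y zy.
  have h1 : `|g x - g z| < e / 2.
    apply: Hr => /=; move: xz; rewrite -ball_normE /= => /lt_trans; apply.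
    by rewrite ltr_pdivrMr// ltr_pMr// ltr1n.
  have h2 : `|g x - g y| < e / 2.
    apply: Hr; rewrite -ball_normE /= -[x](subrK z) -addrA.
    apply: le_lt_trans (ler_normD _ _) _; rewrite [ltRHS]splitr ltrD//.
      by move: xz; rewrite -ball_normE.
    exact: lt_trans zy dr.
  rewrite -[g z](subrK (g x)) -addrA [e]splitr.
  by apply: le_lt_trans (ler_normD _ _) _; rewrite ltrD// distrC.
(* Here [d] is the radius of a right neighbourhood of 0; [d / 2] is a point of it. *)
exists (d / 2); first by rewrite divr_gt0.
move=> x y Mx xy; apply: (Hd (d / 2)) => //=.
- rewrite sub0r normrN gtr0_norm ?divr_gt0//.
  by rewrite ltr_pdivrMr// ltr_pMr// ltr1n.
- by rewrite divr_gt0.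
- by move=> i /=; rewrite in_itv/= -ler_norml.
- rewrite /Num.norm/= mx_normrE; apply/bigmax_ltP; split; first by rewrite divr_gt0.
  by move=> [i j] _ /=; rewrite !mxE ord1.
Qed.

Lemma sup_dist (I : Type) (F G : I -> R) M e : inhabited I ->
  (forall i, `|F i| <= M) -> (forall i, `|G i| <= M) ->
  (forall i, `|F i - G i| <= e) -> `|sup (range F) - sup (range G)| <= e.
Proof.
move=> [i0].
suff H (F' G' : I -> R) : (forall i, `|G' i| <= M) ->
    (forall i, `|F' i - G' i| <= e) -> sup (range F') <= sup (range G') + e.
  move=> FM GM FG; have h1 := H F G GM FG.
  have h2 : sup (range G) <= sup (range F) + e.
    by apply: H => // i; rewrite distrC.
  by rewrite ler_norml; apply/andP; split; lra.
move=> GM FG; apply: ge_sup; first by exists (F' i0), i0.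
move=> _ [i _ <-]; have := FG i; rewrite ler_distl => /andP[_ /le_trans]; apply.
rewrite lerD2r; apply: ub_le_sup; last by exists i.
by exists M => _ [j _ <-]; exact: le_trans (ler_norm _) (GM j).
Qed.

Lemma inf_dist (I : Type) (F G : I -> R) M e : inhabited I ->
  (forall i, `|F i| <= M) -> (forall i, `|G i| <= M) ->
  (forall i, `|F i - G i| <= e) -> `|inf (range F) - inf (range G)| <= e.
Proof.
move=> I0 FM GM FG; rewrite /inf !image_comp -opprD normrN.
apply: (@sup_dist _ _ _ M) => // i /=; rewrite ?normrN//.
by rewrite -opprD normrN.
Qed.

End UniformContinuity.

Section UniformContinuityOfFormulas.
Variables (R : realType) (L : language R).
Implicit Types (A : structure L) (e : R).

Lemma teval_unif A n (v : idx n -> sorts L) s (t : term v s) e : 0 < e ->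
  exists2 d, 0 < d & forall a b : tuple_in (carrier A) v,
    (forall i, mdist (a i) (b i) < d) -> mdist (teval t a) (teval t b) < e.
Proof.
elim: t e => [i|f t IH] e e0; first by exists e.
have [d d0 Hd] := modulus_tuple (@fmod_modulus R L f) e0.
have /choice[r /all_and2[r0 Hr]] : forall i, exists r, 0 < r /\
    forall a b : tuple_in (carrier A) v,
    (forall i, mdist (a i) (b i) < r) ->
    mdist (teval (t i) a) (teval (t i) b) < d.
  by move=> i; have [r ? ?] := IH i d d0; exists r.
have [m m0 Hm] := finite_lower_bound r0.
exists m => // a b ab /=; apply: le_lt_trans (fint_mod _ _) _.
by apply: Hd => i; apply: Hr => j; exact: lt_le_trans (ab j) (Hm i).
Qed.

Lemma carrier_inhabited A s : inhabited (A s).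
Proof. by have [x _] := carrier_nonempty A s. Qed.

(** The symbols have moduli, and connectives are uniformly continuous on the box provided by
    [feval_bounded]. Under a quantifier [d] serves every [x] at once, since a common new entry adds
    no distance. *)
Lemma feval_unif A n (v : idx n -> sorts L) (phi : formula v) e : 0 < e ->
  exists2 d, 0 < d & forall a b : tuple_in (carrier A) v,
    (forall i, mdist (a i) (b i) < d) -> `|feval A phi a - feval A phi b| < e.
Proof.
have tc_lt n' v' s (x : A s) (a b : tuple_in (carrier A) (v' : idx n' -> _)) d :
    0 < d -> (forall i, mdist (a i) (b i) < d) ->
    forall i, mdist (tcons (carrier A) x a i) (tcons (carrier A) x b i) < d.
  by move=> d0 ab [i|] //=; rewrite mdistxx.
elim: phi e => {n v} [n v r t|n v s t1 t2|n v m g gc phi IH|n v s phi IH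
    |n v s phi IH] e e0.
- have [d d0 Hd] := modulus_tuple (@rmod_modulus R L r) e0.
  have /choice[q /all_and2[q0 Hq]] : forall i, exists q, 0 < q /\
      forall a b : tuple_in (carrier A) v,
      (forall i, mdist (a i) (b i) < q) ->
      mdist (teval (t i) a) (teval (t i) b) < d.
    by move=> i; have [q ? ?] := teval_unif A (t i) d0; exists q.
  have [m m0 Hm] := finite_lower_bound q0.
  exists m => // a b ab /=; apply: le_lt_trans (rint_mod _ _) _.
  by apply: Hd => i; apply: Hq => j; exact: lt_le_trans (ab j) (Hm i).
- have e20 : 0 < e / 2 by rewrite divr_gt0.
  have [d1 d10 H1] := teval_unif A t1 e20.
  have [d2 d20 H2] := teval_unif A t2 e20.
  exists (Num.min d1 d2) => [|a b ab /=]; first by rewrite lt_min d10.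
  have {}H1 : mdist (teval t1 a) (teval t1 b) < e / 2.
    by apply: H1 => i; have := ab i; rewrite lt_min => /andP[].
  have {}H2 : mdist (teval t2 a) (teval t2 b) < e / 2.
    by apply: H2 => i; have := ab i; rewrite lt_min => /andP[].
  move: (teval t1 a) (teval t1 b) (teval t2 a) (teval t2 b) H1 H2.
  move=> x x' y y' xx yy.
  have := metric_triangle x x' y; have := metric_triangle x' y' y.
  have := metric_triangle x' x y'; have := metric_triangle x y y'.
  rewrite (metric_sym y' y) (metric_sym x' x) ltr_norml => *.
  by apply/andP; split; lra.
- have /choice[M HM] := fun i => feval_bounded (phi i).
  have [d d0 Hd] := connective_unif M gc e0.
  have /choice[q /all_and2[q0 Hq]] : forall i, exists q, 0 < q /\
      forall a b : tuple_in (carrier A) v,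
      (forall i, mdist (a i) (b i) < q) ->
      `|feval A (phi i) a - feval A (phi i) b| < d.
    by move=> i; have [q ? ?] := IH i d d0; exists q.
  have [p p0 Hp] := finite_lower_bound q0.
  exists p => // a b ab /=; apply: Hd => i; rewrite !mxE //.
  by apply: Hq => j; exact: lt_le_trans (ab j) (Hp i).
(* Suprema preserve only weak inequalities; halving [e] recovers the strict one. *)
- have e20 : 0 < e / 2 by rewrite divr_gt0.
  have [d d0 Hd] := IH _ e20; have [M HM] := feval_bounded phi.
  exists d => // a b ab /=; apply: (@le_lt_trans _ _ (e / 2)); last first.
    by rewrite ltr_pdivrMr// ltr_pMr// ltr1n.
  apply: (@sup_dist _ _ _ _ M) => //; first exact: carrier_inhabited.
  by move=> x; apply/ltW/Hd/tc_lt.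
- have e20 : 0 < e / 2 by rewrite divr_gt0.
  have [d d0 Hd] := IH _ e20; have [M HM] := feval_bounded phi.
  exists d => // a b ab /=; apply: (@le_lt_trans _ _ (e / 2)); last first.
    by rewrite ltr_pdivrMr// ltr_pMr// ltr1n.
  apply: (@inf_dist _ _ _ _ M) => //; first exact: carrier_inhabited.
  by move=> x; apply/ltW/Hd/tc_lt.
Qed.

Lemma finf_le A n (v : idx n -> sorts L) s (phi : formula (vcons s v))
    (a : tuple_in (carrier A) v) (x : A s) :
  feval A (finf s phi) a <= feval A phi (tcons (carrier A) x a).
Proof.
have [M HM] := feval_bounded phi; apply: ge_inf; last by exists x.
exists (- M) => _ [y _ <-].
by have := HM A (tcons (carrier A) y a); rewrite ler_norml => /andP[].
Qed.

Lemma finf_lt A n (v : idx n -> sorts L) s (phi : formula (vcons s v))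
    (a : tuple_in (carrier A) v) e : 0 < e ->
  exists x, feval A phi (tcons (carrier A) x a) < feval A (finf s phi) a + e.
Proof.
move=> e0; have [M HM] := feval_bounded phi.
have [|_ [x _ <-] xe] := @inf_adherent _
    (range (fun x : A s => feval A phi (tcons (carrier A) x a))) e e0.
  split; first by have [x] := carrier_inhabited A s;
    exists (feval A phi (tcons (carrier A) x a)), x.
  exists (- M) => _ [y _ <-].
  by have := HM A (tcons (carrier A) y a); rewrite ler_norml => /andP[].
by exists x.
Qed.

(** Reduces suprema to infima, so that a Tarski-Vaught test for infima covers both quantifiers. *)
Lemma fsupE A n (v : idx n -> sorts L) s (phi : formula (vcons s v))
    (a : tuple_in (carrier A) v) :
  feval A (fsup s phi) a = - feval A (finf s (fscale (-1) phi)) a.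
Proof.
rewrite /= /inf opprK image_comp; congr (sup (_ @` _)); apply/funext => x /=.
by rewrite mxE mulN1r opprK.
Qed.

End UniformContinuityOfFormulas.

(** * The Tarski-Vaught test and the closure of the constants *)

Section Substructure.
Variables (R : realType) (L : language R) (A : structure L) (a : assignment A).

Lemma in_closure_range s (x : A s) : closure (range (a s)) x <->
  forall e, 0 < e -> exists j, mdist x (a s j) < e.
Proof.
split=> [cx e e0|H B].
  have [_ [[j _ <-] xj]] := cx _ (nbhsx_ballx x e e0).
  by exists j; rewrite ballEmdist in xj.
move=> /nbhs_ballP[e /= e0 eB]; have [j xj] := H e e0.
by exists (a s j); split; [exists j|apply: eB; rewrite ballEmdist].
Qed.

Lemma tuple_approx n (v : idx n -> sorts L) (b : tuple_in (carrier A) v) :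
  (forall i, closure (range (a (v i))) (b i)) -> forall d, 0 < d ->
  exists k : idx n -> nat, forall i, mdist (b i) (a (v i) (k i)) < d.
Proof.
move=> cb d d0.
have /choice[k Hk] i : exists j, mdist (b i) (a (v i) j) < d.
  by move: d d0; exact/in_closure_range.
by exists k.
Qed.

(** Parameters and approximate witnesses are both taken among the constants; [tv_closure] passes to
    parameters in their closure. *)
Definition tarski_vaught := forall n (v : idx n -> sorts L) s
  (phi : formula (vcons s v)) (k : idx n -> nat) e, 0 < e ->
  exists j, feval A phi (tcons (carrier A) (a s j) (fun i => a (v i) (k i))) <
    feval A (finf s phi) (fun i => a (v i) (k i)) + e.

Hypothesis tv : tarski_vaught.

Lemma tv_closure n (v : idx n -> sorts L) s (phi : formula (vcons s v))
    (b : tuple_in (carrier A) v) (x : A s) e :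
  (forall i, closure (range (a (v i))) (b i)) -> 0 < e ->
  exists j, feval A phi (tcons (carrier A) (a s j) b) <
    feval A phi (tcons (carrier A) x b) + e.
Proof.
(* One third of [e] pays for the test, and one each for replacing [b] by constants at the witness
   and at [x]. *)
move=> cb e0; have e30 : 0 < e / 3 by rewrite divr_gt0.
have [d d0 Hd] := feval_unif A phi e30.
have [k Hk] := tuple_approx cb d0.
have [j Hj] := tv phi k e30; exists j.
have tc_lt (y : A s) : `|feval A phi (tcons (carrier A) y b) -
    feval A phi (tcons (carrier A) y (fun i => a (v i) (k i)))| < e / 3.
  by apply: Hd => -[i|] //=; rewrite mdistxx.
have := finf_le phi (fun i => a (v i) (k i)) x.
have := tc_lt x; have := tc_lt (a s j); rewrite !ltr_norml.
move: Hj; set u1 := feval _ (finf _ _) _; set u2 := feval _ _ _.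
set u3 := feval _ _ _; set u4 := feval _ _ _; set u5 := feval _ _ _.
by move=> ? /andP[? ?] /andP[? ?] ?; lra.
Qed.

(** The test is applied to the formula [d(y, f(x))], which vanishes at [y = f(b)]. *)
Lemma closure_fint f (b : tuple_in (carrier A) (@fdom R L f)) :
  (forall i, closure (range (a (fdom i))) (b i)) ->
  closure (range (a (fcod f))) (fint A f b).
Proof.
move=> cb; apply/in_closure_range => e e0.
pose v := vcons (fcod f) (@fdom R L f).
pose phi : formula v := @fdist R L _ v (fcod f) (@tvar R L _ v None)
  (@tapp R L _ v f (fun i => @tvar R L _ v (Some i))).
have [j /=] := tv_closure phi (fint A f b) cb e0.
by rewrite mdistxx add0r metric_sym => bj; exists j.
Qed.

(** A type of its own, on which the metric restricted from [A] is declared. *)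
Definition hull s : Type := closure (range (a s)).

HB.instance Definition _ s := Choice.copy (hull s) (set_type (closure (range (a s)))).

Definition hval s (x : hull s) : A s := set_val x.

Lemma hvalP s (x : hull s) : closure (range (a s)) (hval x).
Proof. exact: set_valP. Qed.

Arguments hvalP {s} x _ _.

Lemma hval_inj s : injective (@hval s).
Proof. by move=> x y; rewrite /hval set_valE; exact: val_inj. Qed.

Definition hsub s (x : A s) (cx : closure (range (a s)) x) : hull s :=
  exist _ x (mem_set cx).

Lemma hsubK s (x : A s) cx : hval (@hsub s x cx) = x.
Proof. by rewrite /hval set_valE. Qed.

Let hdist s (x y : hull s) : R := mdist (hval x) (hval y).

Let hdistxx s (x : hull s) : hdist x x = 0.
Proof. exact: mdistxx. Qed.

Let hdist_positivity s (x y : hull s) : hdist x y = 0 -> x = y.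
Proof. by move=> /mdist_positivity/hval_inj. Qed.

Let hdist_sym s (x y : hull s) : hdist x y = hdist y x.
Proof. exact: metric_sym. Qed.

Let hdist_triangle s (y x z : hull s) : hdist x z <= hdist x y + hdist y z.
Proof. exact: metric_triangle. Qed.

HB.instance Definition _ s := isMetric.Build R (hull s) (@hdistxx s)
  (@hdist_positivity s) (@hdist_sym s) (@hdist_triangle s).

Lemma hull_mdist s (x y : hull s) : mdist x y = mdist (hval x) (hval y).
Proof. by []. Qed.

Let hnonempty s : [set: hull s] !=set0.
Proof. by exists (hsub (subset_closure (ex_intro2 _ _ 0%N I erefl))). Qed.

(** The filter is pushed forward to [A], and its limit there is again a limit of constants. *)
Let hcomplete s (F : set_system (hull s)) :
  ProperFilter F -> cauchy F -> exists x : hull s, F --> x.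
Proof.
move=> PF cF.
have PG : ProperFilter (@hval s @ F) by exact: fmap_proper_filter.
have [|x Fx] := @carrier_complete _ _ _ _ (@hval s @ F) PG.
  apply/cauchyP => e e0; have /cauchyP/(_ e e0)[y Fy] := cF.
  exists (hval y); rewrite /= /nbhs /=; apply: (filterS _ Fy) => z /=.
  by rewrite !ballEmdist.
have {}Fx e : 0 < e -> F [set y | mdist x (hval y) < e].
  by move=> e0; have := Fx _ (nbhsx_ballx x e e0); rewrite ballEmdist.
have cx : closure (range (a s)) x.
  apply/in_closure_range => e e0; have e20 : 0 < e / 2 by rewrite divr_gt0.
  have [y /= xy] := filter_ex (Fx _ e20).
  have /in_closure_range/(_ _ e20)[j yj] := hvalP y.
  exists j; apply: le_lt_trans (metric_triangle _ (hval y) _) _.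
  by rewrite [ltRHS]splitr ltrD.
exists (hsub cx); apply/metricType_numDomainType.fcvgrPdist_lt => e e0.
by apply: filterS (Fx e e0) => y; rewrite hull_mdist hsubK.
Qed.

Definition hull_fint f (b : tuple_in hull (@fdom R L f)) : hull (fcod f) :=
  hsub (closure_fint (fun i => hvalP (b i))).

Let hull_bound s (x y : hull s) : mdist x y <= dbound s.
Proof. exact: mdist_bound. Qed.

Lemma hull_tdist n (v : idx n -> sorts L) (b c : tuple_in hull v) :
  @tdist R _ hull _ _ b c =
  @tdist R _ A _ _ (fun i => hval (b i)) (fun i => hval (c i)).
Proof. by []. Qed.

Let hull_fint_mod f (b c : tuple_in hull (@fdom R L f)) :
  mdist (hull_fint b) (hull_fint c) <= fmod f (@tdist R _ hull _ _ b c).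
Proof. by rewrite hull_tdist hull_mdist !hsubK fint_mod. Qed.

Definition hull_structure : structure L :=
  @Structure R L hull hnonempty hcomplete hull_bound hull_fint hull_fint_mod
    (fun r b => rint A r (fun i => hval (b i)))
    (fun r b => rint_range _) (fun r b c => rint_mod _ _).

Definition hull_assignment : assignment hull_structure :=
  fun s j => hsub (subset_closure (ex_intro2 _ _ j I erefl)).

Lemma teval_hull n (v : idx n -> sorts L) s (t : term v s)
    (b : tuple_in hull v) :
  hval (@teval R L hull_structure _ _ _ t b) = teval t (fun i => hval (b i)).
Proof.
elim: t => [//|f t IH] /=; rewrite hsubK; congr fint.
by apply: functional_extensionality_dep => i; rewrite -IH.
Qed.

(** The Tarski-Vaught theorem: infima over [A] are approached at constants by [tv_closure], so
    restricting quantifiers to the hull does not change them. *)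
Lemma feval_hull n (v : idx n -> sorts L) (phi : formula v)
    (b : tuple_in hull v) :
  @feval R L hull_structure _ _ phi b = feval A phi (fun i => hval (b i)).
Proof.
have inf_case m (w : idx m -> sorts L) s (psi : formula (vcons s w))
    (y : tuple_in hull w) :
    (forall c, @feval R L hull_structure _ _ psi c =
      feval A psi (fun i => hval (c i))) ->
    @feval R L hull_structure _ _ (finf s psi) y =
    feval A (finf s psi) (fun i => hval (y i)).
  move=> IH; have tcE (x : hull s) : (fun i => hval (tcons hull x y i)) =
      tcons (carrier A) (hval x) (fun i => hval (y i)).
    by apply: functional_extensionality_dep => -[].
  apply/eqP; rewrite eq_le; apply/andP; split; apply/ler_addgt0Pr => e e0.
    have e20 : 0 < e / 2 by rewrite divr_gt0.
    have [x xe] := finf_lt psi (fun i => hval (y i)) e20.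
    have [j je] := tv_closure psi x (fun i => hvalP (y i)) e20.
    have := @finf_le R L hull_structure m w s psi y (hull_assignment s j).
    rewrite IH tcE hsubK; move: (feval hull_structure _ _) xe je => u.
    move: (feval _ _ _) (feval _ _ _) (feval _ _ _) => u1 u2 u3.
    by move=> *; lra.
  have [x] := @finf_lt R L hull_structure m w s psi y e e0.
  rewrite IH tcE => /ltW; apply: le_trans; exact: finf_le.
elim: phi b => {n v} [n v r t|n v s t1 t2|n v m g gc phi IH|n v s phi IH
    |n v s phi IH] b.
- by rewrite /=; congr rint; apply: functional_extensionality_dep => i; rewrite -teval_hull.
- by rewrite /= hull_mdist !teval_hull.
- by rewrite /=; congr g; apply/rowP => i; rewrite !mxE IH.
- rewrite !fsupE; congr (- _); apply: inf_case => c /=.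
  by congr (_ * _); rewrite !mxE IH.
- exact: inf_case.
Qed.

End Substructure.
Arguments hvalP {R L A a s} x _ _.

(** * Uniqueness of the represented structure *)

Section HullFunctional.
Variables (R : realType) (L : language R) (A : structure L) (a : assignment A).
Hypothesis tv : tarski_vaught a.

Lemma seval_hull phi : seval (hull_structure tv) phi = seval A phi.
Proof. by rewrite /seval feval_hull; congr feval; exact: tuple0_eq. Qed.

(** Eliminating the constants reduces this to [feval_hull], which concerns [L]-formulas only. *)
Lemma functional_hull : functional (hull_assignment tv) = functional a.
Proof.
apply/funext => phi; have [l [psi Hpsi]] := csentence_elim phi.
rewrite -[in LHS](assign_values l (hull_assignment tv)).
rewrite -[in RHS](assign_values l a) !Hpsi feval_hull; congr feval.
apply: functional_extensionality_dep; elim: l {psi Hpsi} => [[]|c l IH].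
by case=> [i|] /=; [exact: IH|rewrite hsubK].
Qed.

Lemma generated_hull : generated (hull_assignment tv).
Proof.
move=> t; apply/seteqP; split=> // x _; apply/in_closure_range => e e0.
have /in_closure_range/(_ _ e0)[j xj] := hvalP x.
by exists j; rewrite hull_mdist hsubK.
Qed.

End HullFunctional.

Section Uniqueness.
Variables (R : realType) (L : language R).
Implicit Types A B : structure L.

(** The graph of the isomorphism to be built: pairs of points approximated by constants with the
    same indices. *)
Definition matched A (a : assignment A) B (b : assignment B) s
    (x : A s) (y : B s) :=
  forall e, 0 < e -> exists j, mdist x (a s j) < e /\ mdist y (b s j) < e.

Lemma matchedC A (a : assignment A) B (b : assignment B) s (x : A s) (y : B s) :
  matched a b x y -> matched b a y x.
Proof. by move=> xy e /xy[j []]; exists j. Qed.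

Lemma generated_approx A (a : assignment A) s (x : A s) e :
  generated a -> 0 < e -> exists j, mdist x (a s j) < e.
Proof. by move=> ga; apply: (in_closure_range a x).1; rewrite ga. Qed.

Lemma functional_feval A (a : assignment A) B (b : assignment B) :
  functional a = functional b ->
  forall n (v : idx n -> sorts L) (phi : formula v) (k : idx n -> nat),
  feval A phi (fun i => a (v i) (k i)) = feval B phi (fun i => b (v i) (k i)).
Proof. by move=> ab n v phi k; rewrite -!instE ab. Qed.

Lemma functional_mdist A (a : assignment A) B (b : assignment B) s i j :
  functional a = functional b ->
  mdist (a s i) (a s j) = mdist (b s i) (b s j).
Proof.
move=> ab; pose v := vcons s (vcons s (@vnil (sorts L))).
exact: (functional_feval ab (@fdist R L _ v s (@tvar R L _ v None)
  (@tvar R L _ v (Some None))) (vcons i (vcons j (@vnil nat)))).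
Qed.

Lemma matched_mdist A (a : assignment A) B (b : assignment B) s
    (x x' : A s) (y y' : B s) :
  functional a = functional b -> matched a b x y -> matched a b x' y' ->
  mdist x x' = mdist y y'.
Proof.
suff H A' (a' : assignment A') B' (b' : assignment B') (z z' : A' s)
    (t t' : B' s) : functional a' = functional b' -> matched a' b' z t ->
    matched a' b' z' t' -> mdist z z' <= mdist t t'.
  move=> ab xy xy'; apply/eqP; rewrite eq_le (H _ _ _ _ _ _ _ _ ab)//.
  by rewrite (H _ _ _ _ _ _ _ _ (esym ab))//; exact: matchedC.
move=> ab zt zt'; apply/ler_addgt0Pr => e e0.
(* Each of [z], [z'], [t], [t'] is approximated by a constant at the cost of a quarter of [e]. *)
have e40 : 0 < e / 4 by rewrite divr_gt0.
have [i [zi ti]] := zt _ e40; have [j [zj tj]] := zt' _ e40.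
have := functional_mdist s i j ab.
have := metric_triangle z (a' s i) z'.
have := metric_triangle (a' s i) (a' s j) z'.
have := metric_triangle (b' s i) t (b' s j).
have := metric_triangle t t' (b' s j).
rewrite (metric_sym (a' s j) z') (metric_sym (b' s i) t); lra.
Qed.

(** The constants of [B] whose indices come from constants close to [x] generate a filter. It is
    Cauchy because distances between constants agree in [A] and [B], and its limit is [y]. *)
Lemma matched_ex A (a : assignment A) B (b : assignment B) s (x : A s) :
  functional a = functional b -> generated a -> exists y, matched a b x y.
Proof.
move=> ab ga; pose D e := [set j | mdist x (a s j) < e].
pose F := filter_from [set e : R | 0 < e] (fun e => b s @` D e).
have PF : ProperFilter F.
  apply: filter_from_proper; last first.
    move=> e e0; have [j xj] := generated_approx x ga e0.
    by exists (b s j), j.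
  apply: filter_from_filter; first by exists 1; rewrite /=.
  move=> e e' /= e0 e0'; exists (Num.min e e'); first by rewrite /= lt_min e0.
  by move=> _ [j + <-]; rewrite /D /= lt_min => /andP[je je']; split; exists j.
have [|y Fy] := @carrier_complete _ _ B s F PF.
  apply/cauchy_exP => e e0; have e20 : 0 < e / 2 by rewrite divr_gt0.
  have [j xj] := generated_approx x ga e20.
  exists (b s j), (e / 2) => // _ [i xi <-]; rewrite ballEmdist /=.
  rewrite -(functional_mdist s j i ab).
  apply: le_lt_trans (metric_triangle _ x _) _.
  by rewrite [ltRHS]splitr ltrD// metric_sym.
exists y => e e0; have [d /= d0 dy] := Fy _ (nbhsx_ballx y e e0).
have [|j] := @generated_approx _ _ _ x (Num.min d e) ga; first by rewrite lt_min d0.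
rewrite lt_min => /andP[jd je]; exists j; split=> //.
have := dy (b s j); rewrite ballEmdist; apply; by exists j.
Qed.

Lemma matched_tuple A (a : assignment A) B (b : assignment B) n
    (v : idx n -> sorts L) (x : tuple_in (carrier A) v)
    (y : tuple_in (carrier B) v) d : (forall i, matched a b (x i) (y i)) ->
  0 < d -> exists k : idx n -> nat, (forall i, mdist (x i) (a (v i) (k i)) < d) /\
    (forall i, mdist (y i) (b (v i) (k i)) < d).
Proof.
move=> xy d0; have /choice[k /all_and2[]] := fun i => xy i d d0.
by exists k.
Qed.

Lemma matched_fint A (a : assignment A) B (b : assignment B) f
    (x : tuple_in (carrier A) (@fdom R L f))
    (y : tuple_in (carrier B) (@fdom R L f)) :
  functional a = functional b -> generated a ->
  (forall i, matched a b (x i) (y i)) ->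
  matched a b (fint A f x) (fint B f y).
Proof.
move=> ab ga xy e e0; have e20 : 0 < e / 2 by rewrite divr_gt0.
have [d d0 Hd] := modulus_tuple (@fmod_modulus R L f) e20.
have [k [xk yk]] := matched_tuple xy d0.
have xf := le_lt_trans (fint_mod _ _) (Hd _ _ _ _ _ _ xk).
have yf := le_lt_trans (fint_mod _ _) (Hd _ _ _ _ _ _ yk).
(* The value of [f] at constants need not be a constant. It is approximated by one in [A], and the
   formula [d(f(x), y)] carries the approximation over to [B]. *)
have [j ja] := generated_approx (fint A f (fun i => a _ (k i))) ga e20.
have jb : mdist (fint B f (fun i => b _ (k i))) (b _ j) < e / 2.
  pose v := vcons (fcod f) (@fdom R L f).
  rewrite (_ : mdist _ _ = mdist (fint A f (fun i => a _ (k i))) (a _ j)) //.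
  symmetry; exact: (functional_feval ab (@fdist R L _ v (fcod f)
    (@tapp R L _ v f (fun i => @tvar R L _ v (Some i)))
    (@tvar R L _ v None)) (vcons j k)).
exists j; rewrite [e]splitr; split.
  exact: le_lt_trans (metric_triangle _ _ _) (ltrD xf ja).
exact: le_lt_trans (metric_triangle _ _ _) (ltrD yf jb).
Qed.

Lemma matched_rint A (a : assignment A) B (b : assignment B) r
    (x : tuple_in (carrier A) (@rdom R L r))
    (y : tuple_in (carrier B) (@rdom R L r)) :
  functional a = functional b -> (forall i, matched a b (x i) (y i)) ->
  rint A r x = rint B r y.
Proof.
move=> ab xy; apply/eqP; rewrite -subr_eq0 -normr_le0; apply/ler_addgt0Pr => e e0.
have e20 : 0 < e / 2 by rewrite divr_gt0.
have [d d0 Hd] := modulus_tuple (@rmod_modulus R L r) e20.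
have [k [xk yk]] := matched_tuple xy d0.
have := le_lt_trans (rint_mod _ _) (Hd _ _ _ _ _ _ xk).
have := le_lt_trans (rint_mod _ _) (Hd _ _ _ _ _ _ yk).
have := functional_feval ab (@Defs.frel R L _ _ r (@tvar R L _ (@rdom R L r))) k.
move=> /= ->; rewrite !ltr_norml add0r ler_norml => /andP[? ?] /andP[? ?].
by apply/andP; split; lra.
Qed.

Lemma functional_isomorphism A (a : assignment A) B (b : assignment B) :
  functional a = functional b -> generated a -> generated b ->
  exists h : forall s, A s -> B s,
    isomorphism h /\ forall s j, h s (a s j) = b s j.
Proof.
move=> ab ga gb.
have /dep_choice[h Hh] s : exists h : A s -> B s, forall x, matched a b x (h x).
  by have /choice[h Hh] := fun x : A s => matched_ex x ab ga; exists h.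
have /dep_choice[g Hg] s : exists g : B s -> A s, forall y, matched b a y (g y).
  by have /choice[g Hg] := fun y : B s => matched_ex y (esym ab) gb; exists g.
(* As [matched] is single-valued, the clauses on constants, inverses and function symbols reduce to
   exhibiting matched pairs. *)
have h_uniq s (x : A s) y : matched a b x y -> h s x = y.
  move=> xy; apply: mdist_positivity.
  by rewrite -(matched_mdist ab (Hh s x) xy) mdistxx.
exists h; split; last first.
  by move=> s j; apply: h_uniq => e e0; exists j; rewrite !mdistxx.
split=> [s|s x y|f x|r x].
- exists (g s) => [x|y]; last exact/h_uniq/matchedC.
  apply: mdist_positivity.
  by rewrite (matched_mdist ab (matchedC (Hg s (h s x))) (Hh s x)) mdistxx.
- by rewrite (matched_mdist ab (Hh s x) (Hh s y)).
- exact/h_uniq/matched_fint.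
- by apply: (matched_rint ab) => i.
Qed.

End Uniqueness.

(** * Loewenheim-Skolem *)

Section Countability.
Variable X : Type.

Lemma countable_of_inj (Y : countType) (f : X -> Y) :
  injective f -> countable [set: X].
Proof.
move=> fI; apply/countable_injP; exists (pickle \o f) => x y _ _ /=.
by move=> /(pcan_inj pickleK)/fI.
Qed.

Lemma countable_enum (D : set X) (x0 : X) : countable D ->
  exists f : nat -> X, D `<=` range f.
Proof.
move=> /countable_injP[f fI].
have /choice[g Hg] m : exists x, (exists2 y, D y & f y = m) -> D x /\ f x = m.
  by have [[y Dy ym]|] := pselect (exists2 y, D y & f y = m); [exists y|exists x0].
exists g => x Dx; exists (f x) => //; have [Dg fg] : D (g (f x)) /\ _ := Hg _ (ex_intro2 _ _ x Dx erefl).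
by apply: fI; rewrite ?inE.
Qed.

Lemma recurrent_enum : countable [set: X] ->
  exists f : nat -> option X, forall x m, exists2 j, (m <= j)%N & f j = Some x.
Proof.
move=> /countable_injP[f fI].
have /choice[g Hg] m : exists o, forall x, f x = m -> o = Some x.
  have [[y ym]|ny] := pselect (exists y, f y = m).
    by exists (Some y) => x xm; congr Some; apply: fI; rewrite ?inE// xm.
  by exists None => x xm; case: ny; exists x.
exists (fun j => g (logn 2 j.+1)) => x m.
(* Then [j.+1] is an odd number times [2 ^ f x], so its 2-adic valuation is [f x], while [j] is at
   least [m]. *)
exists (m.*2.+1 * 2 ^ f x).-1; last first.
  rewrite prednK ?muln_gt0 ?expn_gt0//; apply: Hg.
  by rewrite logn_Gauss ?pfactorK// coprime2n/= odd_double.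
rewrite -ltnS prednK ?muln_gt0 ?expn_gt0//.
rewrite (leq_trans (_ : m < m.*2.+1))%N ?leq_pmulr ?expn_gt0//.
by rewrite ltnS -addnn leq_addr.
Qed.

End Countability.

Lemma small_inverse (R : realType) (e : R) : 0 < e ->
  exists m, m.+1%:R^-1 < e.
Proof.
move=> e0; have := near_infty_natSinv_lt (PosNum e0).
by move=> /filter_ex[m]; exists m.
Qed.

Section LowenheimSkolem.
Variables (R : realType) (L : language R) (T : set (sentence L)).
Implicit Types A : structure L.

Lemma fnorm_dist A n (v : idx n -> sorts L) (phi psi : formula v) a :
  models A T ->
  `|feval A phi a - feval A psi a| <= fnorm T (fadd phi (fscale (-1) psi)).
Proof.
move=> AT; have [M HM] := feval_bounded (fadd phi (fscale (-1) psi)).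
apply: ub_le_sup; first by exists M => _ [B [b [_ ->]]].
by exists A, a; split=> //=; rewrite !mxE /= mxE mulN1r.
Qed.

Hypothesis sepT : separable_language T.

Lemma dense_formulas n (v : idx n -> sorts L) : exists f : nat -> formula v,
  forall phi e, 0 < e -> exists i, forall A (a : tuple_in (carrier A) v),
    models A T -> `|feval A phi a - feval A (f i) a| < e.
Proof.
have [D cD HD] := sepT.2 _ v.
(* The zero formula, a connective without arguments, is the default entry of the enumeration. *)
have no_formula : 'I_0 -> formula v by move=> [].
have zero_continuous : continuous (fun _ : 'rV[R]_0 => 0 : R).
  exact: cst_continuous.
have [f Df] := countable_enum (fconn zero_continuous no_formula) cD.
exists f => phi e e0; have [psi /Df[i _ <-] pe] := HD phi e e0.
by exists i => A a AT; apply: le_lt_trans pe; exact: fnorm_dist.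
Qed.

Definition dense_formula n (v : idx n -> sorts L) : nat -> formula v :=
  sval (cid (dense_formulas v)).

Lemma dense_formulaP n (v : idx n -> sorts L) phi e : 0 < e ->
  exists i, forall A (a : tuple_in (carrier A) v),
    models A T -> `|feval A phi a - feval A (dense_formula v i) a| < e.
Proof. exact: svalP (cid (dense_formulas v)) phi e. Qed.

(** One instance of the Tarski-Vaught test: [task_formula] numbers a formula in a dense sequence,
    [task_index] gives the constants used as parameters, and the tolerance is
    [1/(task_error + 1)]. *)
Record task := Task {
  task_n : nat;
  task_v : idx task_n -> sorts L;
  task_sort : sorts L;
  task_formula : nat;
  task_index : idx task_n -> nat;
  task_error : nat }.

Lemma countable_task : countable [set: task].
Proof.
have /countable_injP[f fI] := sepT.1.
(* Fixing the number of parameters first turns the dependent record into a product. *)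
have -> : [set: task] = \bigcup_n [set t | task_n t = n].
  by apply/seteqP; split=> // t _; exists (task_n t).
apply: bigcup_countable => // n _.
pose F (p : (idx n -> sorts L) * sorts L * nat * (idx n -> nat) * nat) :=
  @Task n p.1.1.1.1 p.1.1.1.2 p.1.1.2 p.1.2 p.2.
have -> : [set t | task_n t = n] = range F.
  apply/seteqP; split=> [[m v s i k e] /= nm|_ [p _ <-]//].
  by case: n / nm @F; exists (v, s, i, k, e).
apply: sub_countable (card_image_le _ _) _.
pose G (p : (idx n -> sorts L) * sorts L * nat * (idx n -> nat) * nat) :=
  ([ffun i => f (p.1.1.1.1 i)], f p.1.1.1.2, p.1.1.2, finfun p.1.2, p.2).
apply: (@countable_of_inj _ _ G) => -[[[[v s] i] k] e] [[[[v' s'] i'] k'] e'].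
rewrite /G /= => -[/ffunP vv ss -> /ffunP kk ->].
congr (_, _, _, _, _); last 2 first.
- by apply: fI; rewrite ?inE.
- by apply/funext => j; have := kk j; rewrite !ffunE.
by apply/funext => j; have := vv j; rewrite !ffunE => /fI; apply; rewrite inE.
Qed.

Definition task_phi (t : task) : formula (vcons (task_sort t) (@task_v t)) :=
  dense_formula _ (task_formula t).

Definition task_holds A (a : assignment A) (t : task) := exists j,
  feval A (task_phi t) (tcons (carrier A) (a (task_sort t) j)
    (fun i => a (task_v (t := t) i) (task_index (t := t) i))) <
  feval A (finf (task_sort t) (task_phi t))
    (fun i => a (task_v (t := t) i) (task_index (t := t) i)) +
  (task_error t).+1%:R^-1.

Lemma tasks_tarski_vaught A (a : assignment A) : models A T ->
  (forall t, task_holds a t) -> tarski_vaught a.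
Proof.
(* The quarters of [e] pay for the dense approximation at the witness and at [x], the tolerance of
   the task, and the gap between the infimum and the value at [x]. *)
move=> AT aH n v s phi k e e0; have e40 : 0 < e / 4 by rewrite divr_gt0.
have [i Hi] := @dense_formulaP _ (vcons s v) phi _ e40.
have [m me] := small_inverse e40.
have [j /=] := aH (Task v s i k m); rewrite /task_phi /= => Hj; exists j.
have [x xe] := finf_lt phi (fun i => a (v i) (k i)) e40.
have := Hi A (tcons (carrier A) x (fun i => a (v i) (k i))) AT.
have := Hi A (tcons (carrier A) (a s j) (fun i => a (v i) (k i))) AT.
have := finf_le (dense_formula (vcons s v) i) (fun i => a (v i) (k i)) x.
have {me}Hj := lt_trans Hj (ler_ltD (lexx _) me).
rewrite !ltr_norml /=; move: xe Hj => /=.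
by move=> ? ? ? /andP[? ?] /andP[? ?]; lra.
Qed.

Lemma tarski_vaught_extension A (a : assignment A) N : models A T ->
  exists b : assignment A, (forall s j, (j < N)%N -> b s j = a s j) /\
    tarski_vaught b.
Proof.
move=> AT; have [tau Htau] := recurrent_enum countable_task.
have /dep_choice[W HW] (bt : assignment A * task) : exists x,
    feval A (task_phi bt.2) (tcons (carrier A) x
      (fun i => bt.1 (task_v (t := bt.2) i) (task_index (t := bt.2) i))) <
    feval A (finf (task_sort bt.2) (task_phi bt.2))
      (fun i => bt.1 (task_v (t := bt.2) i) (task_index (t := bt.2) i)) +
    (task_error bt.2).+1%:R^-1.
  exact: finf_lt.
(* Stage [j] changes at most one constant, the [j]-th of the sort in question, into a witness for
   the task [tau j]; stages below [N] change nothing. *)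
pose step (b : assignment A) j : assignment A :=
  if (j < N)%N then b else
  if tau j is Some t then upd b (task_sort t, j) (W (b, t)) else b.
(* [tau] lists every task infinitely often, so each task comes up after all the
   constants it mentions have received their final values. *)
pose st := fix st j := if j is i.+1 then step (st i) i else a.
have st_stable s i j : (i < j)%N -> st j s i = st i.+1 s i.
  elim: j => // j IH; rewrite ltnS leq_eqVlt => /orP[/eqP<-//|ij].
  rewrite -IH// [LHS]/= /step; case: ifP => // _; case: (tau j) => // t.
  by rewrite upd_other// => -[_ ji]; rewrite ji ltnn in ij.
have stN j : (j <= N)%N -> st j = a.
  by elim: j => //= j IH jN; rewrite /step jN IH// ltnW.
pose b s j := st j.+1 s j; exists b; split.
  by move=> s j jN; rewrite /b stN.
apply: tasks_tarski_vaught => // t.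
have [j] := Htau t (maxn N (\max_i (task_index (t := t) i).+1)).
rewrite geq_max => /andP[Nj kj] tauj; exists j.
have bst : (fun i => b (task_v (t := t) i) (task_index (t := t) i)) =
    (fun i => st j (task_v (t := t) i) (task_index (t := t) i)).
  apply: functional_extensionality_dep => i; rewrite /b st_stable//.
  by apply: leq_trans kj; exact: (leq_bigmax_cond i).
rewrite bst; have -> : b (task_sort t) j = W (st j, t); last exact: HW (st j, t).
rewrite /b /= /step ltnNge Nj /= tauj.
exact: (@upd_same _ _ (st j) (task_sort t, j) (W (st j, t))).
Qed.

End LowenheimSkolem.

(** * The weak* topology *)

Section PointwiseTopology.
Variables (R : realType) (X : Type).

Let proj_onto (x : X) : proj x @` [set: {ptws X -> R}] = [set: R].
Proof. by apply/seteqP; split=> // r _; exists (cst r). Qed.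

Lemma ptws_eval_continuous (x : X) :
  continuous (fun s : {ptws X -> R} => s x).
Proof.
move=> f; have /cvg_sup/(_ x)/cvg_image : f --> f by apply: cvg_id.
move=> /(_ (proj_onto x)) h; apply: cvg_trans h => Q /= [W nbdW <-].
by apply: filterS nbdW; exact: preimage_image.
Qed.

(** The sets containing a box on finitely many coordinates form a filter. It converges to [f] since
    each coordinate does, and so contains every neighbourhood of [f]. *)
Lemma ptws_nbhs_basis (f : {ptws X -> R}) (U : set {ptws X -> R}) :
  nbhs f U -> exists m (x : 'I_m -> X) (e : R),
    0 < e /\ forall g : {ptws X -> R}, (forall i, `|g (x i) - f (x i)| < e) -> U g.
Proof.
pose F : set_system {ptws X -> R} := fun U => exists m (x : 'I_m -> X) (e : R),
  0 < e /\ forall g : {ptws X -> R}, (forall i, `|g (x i) - f (x i)| < e) -> U g.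
have FF : Filter F.
  split=> [|P Q [m [x [e [e0 HP]]]] [n [y [d [d0 HQ]]]]|P Q PQ [m [x [e [e0 HP]]]]].
  - have x0 : 'I_0 -> X by move=> [].
    by exists 0%N, x0, 1.
  - exists (m + n)%N, (fun i : 'I_(m + n) =>
      match fintype.split i with inl i => x i | inr i => y i end).
    exists (Num.min e d); split; first by rewrite lt_min e0.
    move=> g Hg; split.
      apply: HP => i; have := Hg (lshift n i).
      by rewrite (unsplitK (inl i)) lt_min => /andP[].
    apply: HQ => i; have := Hg (rshift m i).
    by rewrite (unsplitK (inr i)) lt_min => /andP[].
  - by exists m, x, e; split=> // g /HP/PQ.
suff : F --> f by apply.
apply/cvg_sup => x; apply/cvg_image; first exact: proj_onto.
move=> B /nbhs_ballP[e /= e0 eB].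
exists (proj x @^-1` B); last exact: image_preimage.
exists 1%N, (fun=> x), e; split=> // g /(_ ord0) gx; apply: eB.
by rewrite -ball_normE /= distrC.
Qed.

End PointwiseTopology.

(** * G_delta sets *)

Section CountableIntersections.
Variable X : topologicalType.

Lemma Gdelta_bigcap (I : Type) (S : I -> set X) : countable [set: I] ->
  (forall i, Gdelta (S i)) -> Gdelta [set x | forall i, S i x].
Proof.
move=> /countable_injP[f fI] GS.
have /choice[F HF] i : exists F : nat -> set X,
    (forall j, open (F j)) /\ S i = \bigcap_j F j.
  by have [F ? ?] := GS i; exists F.
exists (fun n => [set x | forall i j, pickle (f i, j) = n -> F i j x]).
  move=> n; have [[i [j ijn]]|no] :=
      EM (exists i (j : nat), pickle (f i, j) = n).
    rewrite (_ : mkset _ = F i j); first exact: (HF i).1.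
    apply/seteqP; split=> [x /(_ i j ijn)//|x Fx i' j'].
    rewrite -ijn => /(pcan_inj pickleK)[+ ->] => /fI.
    by rewrite !inE => ->.
  rewrite (_ : mkset _ = setT); first exact: openT.
  by apply/seteqP; split=> // x _ i j ijn; case: no; exists i, j.
apply/seteqP; split=> [x Sx n _ i j _|x Fx i].
  by have := Sx i; rewrite (HF i).2; apply.
by rewrite (HF i).2 => j _; apply: (Fx (pickle (f i, j)) Logic.I i j).
Qed.

Lemma Gdelta_setI (S S' : set X) : Gdelta S -> Gdelta S' -> Gdelta (S `&` S').
Proof.
move=> GS GS'.
rewrite (_ : _ `&` _ = [set x | forall b, (if b then S else S') x]).
  by apply: Gdelta_bigcap => [|[]//]; exact: countableP.
apply/seteqP; split=> [x [Sx S'x] []//|x Sx].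
by split; [exact: (Sx true)|exact: (Sx false)].
Qed.

Lemma open_lt_continuous (R : realType) (f : X -> R) c :
  continuous f -> open [set x | f x < c].
Proof. by move=> fc; have /continuousP/(_ [set r | r < c] (@open_lt _ c)) := fc. Qed.

End CountableIntersections.

(** * Dependence of a sentence on finitely many constants *)

Section InfimumOverConstants.
Variables (R : realType) (L : language R).
Implicit Types (A : structure L) (l : seq (sorts L * nat)).

(** The infimum over all free variables is an [L]-sentence, so a complete theory determines its
    value. *)
Fixpoint finfs l : formula (ctx l) -> sentence L :=
  match l return formula (ctx l) -> sentence L with
  | [::] => id
  | c :: l => fun phi => @finfs l (finf c.1 phi)
  end.

Lemma finfs_le A l (phi : formula (ctx l)) (y : tuple_in (carrier A) (ctx l)) :
  seval A (finfs phi) <= feval A phi y.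
Proof.
elim: l phi y => [|c l IH] phi y.
  by rewrite /seval (tuple0_eq (@tnil _ (carrier A)) y).
rewrite -(tconsE y); apply: le_trans (IH _ (fun i => y (Some i))) _.
exact: finf_le.
Qed.

Lemma finfs_lt A l (phi : formula (ctx l)) e : 0 < e ->
  exists y : tuple_in (carrier A) (ctx l),
    feval A phi y < seval A (finfs phi) + e.
Proof.
elim: l phi e => [|c l IH] phi e e0.
  by exists (@tnil _ (carrier A)); rewrite ltrDl.
have e20 : 0 < e / 2 by rewrite divr_gt0.
have [y ye] := IH (finf c.1 phi) _ e20.
have [x xe] := finf_lt phi y e20.
exists (tcons (carrier A) x y); apply: lt_trans xe _.
by rewrite [e in ltRHS]splitr addrA ltrD2r.
Qed.

Lemma index_bound l : exists N, forall c, List.In c l -> (c.2 < N)%N.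
Proof.
elim: l => [|c l [N HN]]; first by exists 0%N.
exists (maxn c.2.+1 N) => d /= [<-|/HN dN]; first by rewrite leq_maxl.
by rewrite leq_max dN orbT.
Qed.

Lemma functional_assign A (a : assignment A) l (psi : formula (ctx l)) phi :
  (forall B b y, functional (@assign _ (carrier B) l b y) phi = feval B psi y) ->
  functional a phi = feval A psi (values l a).
Proof. by move=> /(_ A a (values l a)); rewrite assign_values. Qed.

(** [N] exceeds the indices of the finitely many constants in [phi]. *)
Lemma functional_local (phi : csentence L) : exists N,
  forall A (a b : assignment A), (forall s j, (j < N)%N -> b s j = a s j) ->
  functional b phi = functional a phi.
Proof.
have [l [psi Hpsi]] := csentence_elim phi; have [N HN] := index_bound l.
exists N => A a b ab; rewrite !(functional_assign _ Hpsi); congr feval.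
by apply: values_eq => c /HN; exact: ab.
Qed.

Lemma assignment_inhabited A : inhabited (assignment A).
Proof.
have /dep_choice[x _] s : exists x : A s, True.
  by have [x _] := carrier_nonempty A s; exists x.
by split=> s _; exact: x.
Qed.

End InfimumOverConstants.

Section FunctionalSpace.
Variables (R : realType) (L : language R) (T : set (sentence L)).
Implicit Types A : structure L.

Lemma functional_spaceP (t : functional_space T) :
  exists A (a : assignment A), models A T /\ set_val t = functional a.
Proof. by have [A [a sE]] := @set_valP _ (functional_space T) t; exists A, a. Qed.

(* Since [|phi_1 - r_1|, .., |phi_m - r_m|] are combined by a connective, one
   sentence suffices to describe a basic weak* neighbourhood. *)
Lemma functional_space_basis (O : set (functional_space T)) s :
  open O -> O s -> exists phi e, [/\ 0 < e, set_val s phi = 0 &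
    forall t : functional_space T, set_val t phi < e -> O t].
Proof.
move=> [U oU <-] Us.
have [m [x [e [e0 He]]]] := ptws_nbhs_basis (open_nbhs_nbhs (conj oU Us)).
pose r := \row_i set_val s (x i).
have gc : continuous (fun y : 'rV[R]_m => `|y - r|).
  move=> y; apply: continuous_comp; last exact: norm_continuous.
  by apply: continuousB; [exact: cvg_id|exact: cst_continuous].
pose phi : csentence L := fconn gc x.
have phiE (t : functional_space T) :
    set_val t phi = `|\row_i set_val t (x i) - r|.
  by have [A [a [_ ->]]] := functional_spaceP t.
exists phi, e; split=> [//||t]; rewrite phiE; first by rewrite subrr normr0.
move=> te; apply: He => i; apply: le_lt_trans te.
rewrite [leRHS]mx_normrE; apply: le_trans (le_bigmax _ _ (ord0, i)).
by rewrite /= !mxE.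
Qed.

End FunctionalSpace.

(** * G_delta conditions on functionals *)

Section GdeltaConditions.
Variables (R : realType) (L : language R) (T : set (sentence L)).
Hypothesis sepT : separable_language T.
(** The space is abstract so as to cover both [functional_space T] and its subspace of generic
    functionals. *)
Variables (X : topologicalType) (ev : X -> csentence L -> R).
Hypothesis ev_continuous : forall phi, continuous (ev ^~ phi).
Hypothesis ev_functional : forall x,
  exists A (a : assignment A), models A T /\ ev x = functional a.

Lemma open_ev_lt phi c : open [set x | ev x phi < c].
Proof. exact: open_lt_continuous. Qed.

(** The condition [task_holds] expressed by values of [s], without a chosen structure. *)
Definition task_condition (s : csentence L -> R) (t : task L) := exists j,
  s (inst (task_phi sepT t) (vcons j (@task_index _ _ t))) <
  s (inst (finf (task_sort t) (task_phi sepT t)) (@task_index _ _ t)) +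
    (task_error t).+1%:R^-1.

Lemma Gdelta_task_condition :
  Gdelta [set x | forall t, task_condition (ev x) t].
Proof.
apply: (@Gdelta_bigcap _ _ (fun t => [set x | task_condition (ev x) t])).
  exact: (countable_task sepT).
move=> t; apply: open_Gdelta.
rewrite (_ : mkset _ = \bigcup_j [set x |
  ev x (inst (task_phi sepT t) (vcons j (@task_index _ _ t))) -
  ev x (inst (finf (task_sort t) (task_phi sepT t)) (@task_index _ _ t)) <
    (task_error t).+1%:R^-1]); last first.
  by apply/seteqP; split=> x [j]; [exists j|move=> _ h; exists j];
    rewrite /= ?ltrBlDl// -ltrBlDl.
apply: bigcup_open => j _; apply: open_lt_continuous => x.
by apply: continuousB; exact: ev_continuous.
Qed.

Variables (T' : set (sentence L)) (n : nat -> nat)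
  (v : forall k, idx (n k) -> sorts L) (F : forall k, set (formula (@v k))).

(** The definition of [P] at constants only, with the infimum condition split into conditions open
    in [s]. *)
Definition P_condition (s : csentence L -> R) :=
  (forall phi, T' phi -> s (inst phi (@vnil nat)) = 0) /\
  forall k (i : idx (n k) -> nat) m, exists2 phi, F phi &
    s (inst phi i) < m.+1%:R^-1.

(* [T'] may be uncountable: it is replaced by the members of a countable dense
   set of sentences that are close to it. *)
Lemma Gdelta_theory :
  Gdelta [set x | forall phi, T' phi -> ev x (inst phi (@vnil nat)) = 0].
Proof.
pose close (dm : nat * nat) := exists2 phi, T' phi &
  forall A a, models A T ->
  `|feval A phi a - feval A (dense_formula sepT (@vnil _) dm.1) a| < dm.2.+1%:R^-1.
pose S (dm : nat * nat) := [set x | close dm ->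
  `|ev x (inst (dense_formula sepT (@vnil _) dm.1) (@vnil nat))| < dm.2.+1%:R^-1].
rewrite (_ : mkset _ = [set x | forall dm, S dm x]).
  apply: Gdelta_bigcap => [|dm]; first exact: countableP.
  apply: open_Gdelta; have [cl|ncl] := pselect (close dm); last first.
    by rewrite (_ : S dm = setT); [exact: openT|apply/seteqP; split=> // x _ /ncl].
  rewrite (_ : S dm = [set x |
    `|ev x (inst (dense_formula sepT (@vnil _) dm.1) (@vnil nat))| < dm.2.+1%:R^-1]).
    apply: open_lt_continuous => x; apply: continuous_comp.
      exact: ev_continuous.
    exact: norm_continuous.
  by apply/seteqP; split=> x Sx //; exact: Sx.
apply/seteqP; split=> x Hx.
  move=> dm [phi T'phi Hphi]; have [A [a [AT xE]]] := ev_functional x.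
  have := Hphi A (fun i => a _ (@vnil nat i)) AT.
  by rewrite -!instE -xE (Hx _ T'phi) sub0r normrN.
move=> phi T'phi; apply/eqP; rewrite -normr_le0; apply/ler_addgt0Pr => e e0.
have e20 : 0 < e / 2 by rewrite divr_gt0.
have [m me] := small_inverse e20.
have [|d Hd] := @dense_formulaP _ _ _ sepT _ (@vnil _) phi m.+1%:R^-1.
  by rewrite invr_gt0.
have [A [a [AT xE]]] := ev_functional x.
have := Hd A (fun i => a _ (@vnil nat i)) AT.
have := Hx (d, m) (ex_intro2 _ _ phi T'phi Hd).
rewrite /= -!instE -xE; set q := ev x (inst (dense_formula _ _ _) _); set p := ev x _ => qm pqm.
rewrite add0r -[p](subrK q); apply: le_trans (ler_normD _ _) _.
rewrite [leRHS]splitr lerD//; last exact: ltW (lt_trans qm me).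
exact: ltW (lt_trans pqm me).
Qed.

Lemma Gdelta_P_condition : Gdelta [set x | P_condition (ev x)].
Proof.
apply: Gdelta_setI; first exact: Gdelta_theory.
apply: (@Gdelta_bigcap _ _ (fun k => [set x | forall i m, exists2 phi, @F k phi &
  ev x (inst phi i) < m.+1%:R^-1])); first exact: countableP.
move=> k; apply: (@Gdelta_bigcap _ _ (fun i => [set x | forall m, exists2 phi,
  @F k phi & ev x (inst phi i) < m.+1%:R^-1])).
  apply: (@countable_of_inj _ _ (fun i : idx (n k) -> nat => finfun i)).
  by move=> i i' /ffunP ii; apply/funext => j; have := ii j; rewrite !ffunE.
move=> i; apply: (@Gdelta_bigcap _ _ (fun m => [set x | exists2 phi,
  @F k phi & ev x (inst phi i) < m.+1%:R^-1])); first exact: countableP.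
move=> m; apply: open_Gdelta.
by apply: (@bigcup_open _ _ (@F k)) => phi _; exact: open_ev_lt.
Qed.

End GdeltaConditions.

(** * Uniform families at the constants *)

Section UniformFamilies.
Variables (R : realType) (L : language R) (T' : set (sentence L)).
Variables (n : nat -> nat) (v : forall k, idx (n k) -> sorts L)
  (F : forall k, set (formula (@v k))).
Hypothesis F_uniform : forall k, uniform_family T' (@F k).
Variables (A : structure L) (a : assignment A).

Let has_P := models A T' /\ forall k (b : tuple_in (carrier A) (@v k)),
  ereal_inf [set (feval A phi b)%:E | phi in @F k] = 0%E.

Let sentence_inst (phi : sentence L) :
  functional a (inst phi (@vnil nat)) = seval A phi.
Proof. by rewrite instE; congr feval; exact: tuple0_eq. Qed.

Lemma P_condition_functional : has_P -> P_condition T' F (functional a).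
Proof.
move=> [AT' infF]; split=> [phi /AT'|k i m]; first by rewrite sentence_inst.
have /ereal_inf_lt[_ [phi Fphi <-]] :
    (ereal_inf [set (feval A phi (fun j => a (v j) (i j)))%:E | phi in @F k] <
    (m.+1%:R^-1)%:E)%E by rewrite infF lte_fin invr_gt0.
by rewrite lte_fin -instE; exists phi.
Qed.

(** The formula [phi] is found only after [b] has been approximated by constants; the modulus common
    to the family lets [d] be chosen beforehand. *)
Lemma P_of_condition : generated a -> P_condition T' F (functional a) -> has_P.
Proof.
move=> ga [Hth HF]; have AT' : models A T'.
  by move=> phi /Hth; rewrite sentence_inst.
split=> // k b; have [_ F0 [u um uF]] := F_uniform k.
apply/eqP; rewrite eq_le; apply/andP; split; last first.
  by apply: le_ereal_inf_tmp => _ [phi Fphi <-]; rewrite lee_fin; exact: F0.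
apply/lee_addgt0Pr => e e0; have e20 : 0 < e / 2 by rewrite divr_gt0.
have [d d0 Hd] := modulus_tuple um e20.
have [|i Hi] := @tuple_approx _ _ _ a _ _ b _ _ d0.
  by move=> i; rewrite ga.
have [m me] := small_inverse e20; have [phi Fphi] := HF k i m.
rewrite instE add0e => phim.
apply: (@le_trans _ _ (feval A phi b)%:E).
  by apply: ereal_inf_lbound; exists phi.
have := le_lt_trans (uF _ Fphi _ AT' _ _) (Hd _ _ _ _ _ _ Hi).
by rewrite lee_fin ltr_norml => /andP[_]; have := lt_trans phim me; lra.
Qed.

End UniformFamilies.

(** * Generic functionals *)

Section GenericFunctionals.
Variables (R : realType) (L : language R) (T : set (sentence L)).
Hypothesis sepT : separable_language T.

Lemma task_condition_functional (A : structure L) (a : assignment A) t :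
  task_condition sepT (functional a) t <-> task_holds sepT a t.
Proof.
split=> -[j Hj]; exists j; move: Hj; rewrite !instE; congr (feval _ _ _ < _).
  by apply: functional_extensionality_dep => -[].
by apply: functional_extensionality_dep => -[].
Qed.

Definition generic : set (functional_space T) :=
  [set s | forall t, task_condition sepT (set_val s) t].

Definition functional_point (A : structure L) (a : assignment A)
    (AT : models A T) : functional_space T :=
  exist _ (functional a) (mem_set (ex_intro _ A (ex_intro _ a (conj AT erefl)))).

Lemma functional_pointE (A : structure L) (a : assignment A) (AT : models A T) :
  set_val (functional_point a AT) = functional a.
Proof. by rewrite set_valE. Qed.

Lemma generic_functional (A : structure L) (a : assignment A)
  (AT : models A T) : generic (functional_point a AT) <-> tarski_vaught a.
Proof.
split=> [ga|tv t].
  apply: (tasks_tarski_vaught AT) => t; apply/task_condition_functional.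
  by rewrite -functional_pointE; exact: ga.
rewrite functional_pointE; apply/task_condition_functional.
by apply: tv; rewrite invr_gt0.
Qed.

(** Any pair realizing [s] passes the Tarski-Vaught test; the closure of its constants still
    realizes [s] and is generated by them. *)
Lemma generic_represents (s : functional_space T) : generic s ->
  exists Aa : {A : structure L & assignment A}, represents s (projT2 Aa).
Proof.
have [A [a [AT sE]]] := functional_spaceP s => gs.
have tv : tarski_vaught a.
  apply: (tasks_tarski_vaught AT) => t; apply/task_condition_functional.
  by rewrite -sE.
exists (existT _ (hull_structure tv) (hull_assignment tv)); split=> /=.
- by move=> phi /AT; rewrite seval_hull.
- exact: generated_hull.
- by rewrite functional_hull.
Qed.

(** Only constants too late to occur in [phi] are changed. *)
Lemma generic_near (A : structure L) (a : assignment A) (AT : models A T) phi :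
  exists2 b : assignment A, tarski_vaught b & functional b phi = functional a phi.
Proof.
have [N HN] := functional_local phi.
have [b [ab tv]] := tarski_vaught_extension sepT a N AT.
by exists b => //; exact: HN.
Qed.

Lemma dense_generic : dense generic.
Proof.
move=> O [s Os] oO; have [phi [e [e0 sphi HO]]] := functional_space_basis oO Os.
have [A [a [AT sE]]] := functional_spaceP s.
have [b tv bphi] := generic_near a AT phi.
exists (functional_point b AT); split; last exact/generic_functional.
by apply: HO; rewrite functional_pointE bphi -sE sphi.
Qed.

Lemma set_val_continuous (X : topologicalType) (S : set X) :
  continuous (fun x : S => set_val x : X).
Proof. exact: initial_continuous. Qed.

Lemma functional_space_eval_continuous phi :
  continuous (fun s : functional_space T => (set_val s : _ -> R) phi).
Proof.
move=> s; apply: (@continuous_comp _ _ _ (fun s : functional_space T => set_val s)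
  (fun f : {ptws csentence L -> R} => f phi)).
  exact: set_val_continuous.
exact: ptws_eval_continuous.
Qed.

Lemma generic_eval_continuous phi :
  continuous (fun s : generic => (set_val (set_val s) : _ -> R) phi).
Proof.
move=> s; apply: (@continuous_comp _ _ _ (fun s : generic => set_val s)
  (fun s : functional_space T => (set_val s : _ -> R) phi)).
  exact: set_val_continuous.
exact: functional_space_eval_continuous.
Qed.

Lemma Gdelta_generic : Gdelta generic.
Proof.
exact: (@Gdelta_task_condition _ _ _ sepT _
  (fun s : functional_space T => set_val s) functional_space_eval_continuous).
Qed.

Definition generic_point (s : functional_space T) (gs : generic s) : generic :=
  exist _ s (mem_set gs).

Lemma generic_pointE (s : functional_space T) (gs : generic s) :
  set_val (generic_point gs) = s.
Proof. by rewrite set_valE. Qed.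

Lemma genericP (s : generic) : generic (set_val s).
Proof. exact: (@set_valP _ generic s). Qed.

End GenericFunctionals.

(** * Transfer between models of a complete theory, and the theorem *)

(** The infimum of [psi] over all its variables is the same in [A] and [B], and in [A] it is at most
    the value of [phi]; the gap below [e] leaves room for a tuple in [B]. *)
Lemma complete_transfer (R : realType) (L : language R) (T : set (sentence L))
    (A B : structure L) (a : assignment A) phi e :
  complete_theory T -> models A T -> models B T ->
  functional a phi < e -> exists b : assignment B, functional b phi < e.
Proof.
move=> cT AT BT ae; have [l [psi Hpsi]] := csentence_elim phi.
have d0 : 0 < e - functional a phi by rewrite subr_gt0.
have [y ye] := @finfs_lt _ _ B l psi _ d0.
have [b0] := assignment_inhabited B; exists (assign l b0 y).
rewrite Hpsi; apply: lt_le_trans ye _.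
rewrite (cT B A)// -[leRHS](subrK (functional a phi)) addrC lerD2l.
by rewrite (functional_assign a Hpsi) finfs_le.
Qed.

Theorem theorem6p2p1 (R : realType) (L : language R) (T : set (sentence L))
    (P : structure L -> Prop)
    (L_separable : separable_language T)
    (P_definable : definable_by_uniform_families P)
    (T_P : exists A : structure L, models A T /\ P A) :
  exists (G : set (functional_space T)) (A_ : G -> structure L)
         (a_ : forall s : G, assignment (A_ s)),
    let G_P : set G := [set s : G | P (A_ s)] in
    [/\ [/\ dense G, Gdelta G &
            forall s : G,
              represents (set_val s) (a_ s) /\
              forall (B : structure L) (b : assignment B),
                represents (set_val s) b ->
                exists h : forall t, A_ s t -> B t,
                  isomorphism h /\ forall t j, h t (a_ s t j) = b t j],
        G_P !=set0 /\ Gdelta G_P &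
        complete_theory T -> dense G_P].
Proof.
have [T' [n [v [F [F_uniform P_iff]]]]] := P_definable.
have [A0 [A0T PA0]] := T_P.
pose G := generic L_separable.
have /choice[M HM] (s : G) : exists Aa : {A : structure L & assignment A},
    represents (set_val s) (projT2 Aa).
  exact: generic_represents (genericP s).
exists G, (fun s => projT1 (M s)), (fun s => projT2 (M s)) => G_P.
(* Membership in [G_P] thus depends on the values of [s], not on the model chosen by [M]. *)
have G_PE (s : G) : G_P s <-> P_condition T' F (set_val (set_val s)).
  have [_ gen sE] := HM s; rewrite sE; split.
    by move=> /P_iff; exact: P_condition_functional.
  by move=> /(P_of_condition F_uniform gen) ?; apply/P_iff.
(* The model chosen for [s] need not be [A0] itself; it inherits [P] through the condition on
   [s]. *)
have A0_point (b : assignment A0) : tarski_vaught b ->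
    exists2 s : G, G_P s & set_val (set_val s) = functional b.
  move=> tv.
  have gb := (generic_functional L_separable b A0T).2 tv.
  exists (generic_point gb); last by rewrite generic_pointE functional_pointE.
  apply/G_PE; rewrite generic_pointE functional_pointE.
  by apply: P_condition_functional; apply/P_iff.
split.
- split; [exact: dense_generic|exact: Gdelta_generic|move=> s].
  split=> [|B b [_ genb bE]]; first exact: HM.
  have [_ gena aE] := HM s.
  by apply: functional_isomorphism => //; rewrite -aE.
- split.
    have [a] := assignment_inhabited A0.
    have [b [_ tv]] := tarski_vaught_extension L_separable a 0 A0T.
    by have [s Ps _] := A0_point b tv; exists s.
  rewrite (_ : G_P = [set s | P_condition T' F (set_val (set_val s))]).
    apply: (Gdelta_P_condition L_separable).
    - exact: generic_eval_continuous.
    - by move=> s; exact: functional_spaceP.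
  by apply/seteqP; split=> s /G_PE.
- move=> cT O [s Os] [U oU UE]; rewrite -UE in Os.
  have [phi [e [e0 sphi HO]]] := functional_space_basis oU Os.
  have [A [a [AT sE]]] := functional_spaceP (set_val s).
  (* The constants are moved to [A0] first, then made generic there without changing the value of
     [phi]. *)
  have [|b be] := @complete_transfer _ _ _ A A0 a phi e cT AT A0T.
    by rewrite -sE sphi.
  have [c tv cphi] := generic_near L_separable b A0T phi.
  have [t Pt tE] := A0_point c tv.
  by exists t; split=> //; rewrite -UE; apply: HO; rewrite tE cphi.
Qed.
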